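(* Let $A\in\mathbb{R}^{m\times n}$, $b\in\mathbb{R}^m$, $c\in\mathbb{R}^n$ be LP data satisfying the Assumption in the context, and suppose $c\in\operatorname{Null}(A)$. Run Algorithm rPDHG (see context) starting from $z^{0,0}=(x^{0,0},y^{0,0})=(0,0)$ with the $\beta$-restart condition, $\beta:=1/e$ ($e$ the base of the natural logarithm), and step-sizes $$\tau=\frac{\|q\|}{2\kappa\|c\|},\qquad \sigma=\frac{\|c\|}{2\|q\|\lambda_{\max}\lambda_{\min}} .$$ Let $\varepsilon>0$, and let $T$ be the total number of PDHGstep iterations that are run in order to obtain $n$ for which $(x^{n,0},s^{n,0})$ satisfies $\mathcal{E}_d(x^{n,0},s^{n,0})\le\varepsilon$, where $s^{n,0}:=c-A^\top y^{n,0}$. Then $$T\ \le\ 5e\cdot\mathcal{N}\cdot\ln\left(\mathcal{N}\,\mathcal{D}\cdot\frac{\mathcal{E}_d(x^{0,0},s^{0,0})}{\varepsilon}\right)+1,$$ where $$\mathcal{N}:=8.5\,\kappa\left(\frac1{\mu_p}+\frac1{\mu_d}\right)\left(\theta_p^\star+\theta_d^\star+\frac{\operatorname{Dist}(0,\mathcal{X}^\star)}{\operatorname{Dist}(0,V_p)}+\frac{\operatorname{Dist}(c,\mathcal{S}^\star)}{\operatorname{Dist}(0,V_d)}\right),\qquad \mathcal{D}:=32e\cdot\kappa\cdot\max\left\{\frac{\|c\|}{\|b\|_Q},\frac{\|b\|_Q}{\|c\|}\right\}.$$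
   Context: All norms are Euclidean unless indicated; $\operatorname{Dist}(v,\mathcal V)$ is Euclidean distance to a set. LP setting. Primal: $\min c^\top x$ s.t. $Ax=b,\ x\ge0$. Dual: $\max b^\top y$ s.t. $A^\top y+s=c,\ s\ge0$. Put $q:=A^\top(AA^\top)^\dagger b$ ($\dagger$ = Moore–Penrose inverse) and $\|b\|_Q:=\|A^\top(AA^\top)^\dagger b\|=\|q\|$, $V_p:=\{x:Ax=b\}$, $V_d:=c+\operatorname{Im}(A^\top)$, $\mathcal{F}_p:=V_p\cap\mathbb{R}^n_+$, $\mathcal{F}_d:=V_d\cap\mathbb{R}^n_+$. In terms of slacks the dual is $\max q^\top(c-s)$ s.t. $s\in\mathcal{F}_d$. $\mathcal{X}^\star,\mathcal{Y}^\star,\mathcal{S}^\star$ are the sets of optimal $x$, $y$, $s$; $\mathcal{Z}^\star:=\mathcal{X}^\star\times\mathcal{Y}^\star$ is the set of saddlepoints of $L(x,y):=c^\top x+b^\top y-x^\top A^\top y$ over $x\in\mathbb{R}^n_+$ (min), $y\in\mathbb{R}^m$ (max). Assumption: the primal has an optimal solution, and non-optimal feasible solutions exist for both the primal and the dual (equivalently, for the primal in $x$ and the dual in the slack variable $s$). $\lambda_{\max},\lambda_{\min}$ are the largest and smallest nonzero singular values of $A$, and $\kappa:=\lambda_{\max}/\lambda_{\min}$. Limiting error ratios: $\theta_p(x):=\operatorname{Dist}(x,\mathcal{F}_p)/\operatorname{Dist}(x,\mathbb{R}^n_+)$ for $x\in V_p\setminus\mathcal{F}_p$ and $\theta_p(x):=1$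 for $x\in\mathcal{F}_p$; $\theta_p^\star:=\lim_{\epsilon\to0}\sup\{\theta_p(x):x\in V_p,\ \operatorname{Dist}(x,\mathcal{X}^\star)\le\epsilon\}$. Similarly $\theta_d(s)$ and $\theta_d^\star$ are defined with $V_d,\mathcal{F}_d,\mathcal{S}^\star$ in place of $V_p,\mathcal{F}_p,\mathcal{X}^\star$. LP sharpness: $\mu_p:=\inf_{x\in\mathcal{F}_p\setminus\mathcal{X}^\star}\operatorname{Dist}(x,V_p\cap H_p^\star)/\operatorname{Dist}(x,\mathcal{X}^\star)$ with $H_p^\star:=\{\hat x\in\mathbb{R}^n:c^\top\hat x=c^\top x^\star\}$, $x^\star\in\mathcal{X}^\star$; $\mu_d:=\inf_{s\in\mathcal{F}_d\setminus\mathcal{S}^\star}\operatorname{Dist}(s,V_d\cap H_d^\star)/\operatorname{Dist}(s,\mathcal{S}^\star)$ with $H_d^\star:=\{\hat s\in\mathbb{R}^n:q^\top(c-\hat s)=q^\top(c-s^\star)\}$, $s^\star\in\mathcal{S}^\star$. Distance to optima: $\mathcal{E}_d(x,s):=\max\{\operatorname{Dist}(x,\mathcal{X}^\star),\operatorname{Dist}(s,\mathcal{S}^\star)\}$. PDHGstep with step-sizes $\tau,\sigma$: from $z=(x,y)$ produce $z^+=(x^+,y^+)$ with $x^+:=P_{\mathbb{R}^n_+}(x-\tau(c-A^\top y))$, $y^+:=y+\sigma(b-A(2x^+-x))$, where $P_{\mathbb{R}^n_+}$ is Euclidean projection. $M:=\begin{pmatrix}\frac1\tau I_n&-A^\top\\-A&\frac1\sigma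 I_m\end{pmatrix}$, $\|z\|_M:=\sqrt{z^\top Mz}$. Normalized duality gap: for $z=(x,y)\in\mathbb{R}^n_+\times\mathbb{R}^m$ and $r>0$, $\rho(r;z):=\frac1r\max\{L(x,\hat y)-L(\hat x,y):\hat x\ge0,\ \|(\hat x,\hat y)-z\|_M\le r\}$. Algorithm rPDHG. Start with $z^{0,0}$, $n=0$. Outer loop $n$: set $k=0$; repeat $z^{n,k+1}:=\text{PDHGstep}(z^{n,k})$, $\bar z^{n,k+1}:=\frac1{k+1}\sum_{i=1}^{k+1}z^{n,i}$, $k:=k+1$, until $(n,k)$ satisfies the restart condition; then set $z^{n+1,0}:=\bar z^{n,k}$, $n:=n+1$. Stop if $z^{n,0}$ is a saddlepoint (or another convergence condition holds). The $\beta$-restart condition holds at $(n,k)$ if either $n=0$ and $k=1$, or $n\ge1$ and $\rho(\|\bar z^{n,k}-z^{n,0}\|_M;\bar z^{n,k})\le\beta\cdot\rho(\|z^{n,0}-z^{n-1,0}\|_M;z^{n,0})$. Write $z^{n,k}=(x^{n,k},y^{n,k})$.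
   Formalization: The bound is stated as T ≤ max{0, 5e·N·ln(N·D·E_d(x^{0,0},s^{0,0})/ε)+1}, because for very large ε the printed right-hand side is negative while T = 0. *)

(* Defs.v *)
From mathcomp Require Import all_boot all_order all_algebra.
From mathcomp Require Import all_classical all_reals all_analysis.
Set Implicit Arguments.
Unset Strict Implicit.
Unset Printing Implicit Defensive.
Import Order.TTheory GRing.Theory Num.Theory.
Import numFieldNormedType.Exports.
Local Open Scope classical_set_scope.
Local Open Scope ring_scope.

Section Euclidean.
Context {R : realType}.

Definition dot n (u v : 'cV[R]_n) : R := (u^T *m v) 0 0.

(* The library norm on matrices is the max norm, hence this definition. *)
Definition enorm n (v : 'cV[R]_n) : R := Num.sqrt (dot v v).

(* Junk value 0 when C is empty. *)
Definition Dist n (v : 'cV[R]_n) (C : set 'cV[R]_n) : R :=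
  inf [set enorm (v - w) | w in C].

Definition orthant {n} : set 'cV[R]_n := [set x | forall i, 0 <= x i 0].

Definition is_proj n (C : set 'cV[R]_n) (v w : 'cV[R]_n) : Prop :=
  C w /\ forall u, C u -> enorm (v - w) <= enorm (v - u).

(* Junk value v when v has no nearest point in C; the nearest point exists and
   is unique for C = orthant. *)
Definition proj n (C : set 'cV[R]_n) (v : 'cV[R]_n) : 'cV[R]_n :=
  xget v (is_proj C v).

(* The four Penrose equations, which have exactly one solution G. *)
Definition is_pinv m n (B : 'M[R]_(m, n)) (G : 'M[R]_(n, m)) : Prop :=
  [/\ B *m G *m B = B, G *m B *m G = G,
      (B *m G)^T = B *m G & (G *m B)^T = G *m B].

Definition pinv m n (B : 'M[R]_(m, n)) : 'M[R]_(n, m) := xget 0 (is_pinv B).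

(* A finite set, nonempty when B != 0, so that sup and inf below are its
   maximum and minimum. *)
Definition nz_sing_vals m n (B : 'M[R]_(m, n)) : set R :=
  [set l | 0 < l /\ eigenvalue (B^T *m B) (l ^+ 2)].

Definition lam_max m n (B : 'M[R]_(m, n)) : R := sup (nz_sing_vals B).
Definition lam_min m n (B : 'M[R]_(m, n)) : R := inf (nz_sing_vals B).
Definition kappa m n (B : 'M[R]_(m, n)) : R := lam_max B / lam_min B.

End Euclidean.

(* V is an affine subspace, the feasible set is V `&` orthant, Opt is the set
   of optimal solutions and H the hyperplane of optimal objective value.  The
   primal and the dual (in its slack variable) are both of this form. *)
Section Geometry.
Context {R : realType} {n : nat}.
Implicit Types V H Opt : set 'cV[R]_n.

Definition theta V (x : 'cV[R]_n) : R :=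
  if `[< (V `&` orthant) x >] then 1
  else Dist x (V `&` orthant) / Dist x orthant.

(* By Hoffman's error bound theta is bounded on V, so that the real-valued sup
   is a genuine supremum; it is nondecreasing in eps. *)
Definition theta_star V Opt : R :=
  lim (sup [set theta V x | x in [set x | V x /\ Dist x Opt <= eps]]
       @[eps --> 0^'+]).

Definition sharpness V H Opt : R :=
  inf [set Dist x (V `&` H) / Dist x Opt | x in (V `&` orthant) `\` Opt].

End Geometry.

Section LinearProgram.
Context {R : realType} {m n : nat}.
Variables (A : 'M[R]_(m, n)) (b : 'cV[R]_m) (c : 'cV[R]_n).

Definition qvec : 'cV[R]_n := A^T *m pinv (A *m A^T) *m b.
Definition normQ : R := enorm qvec.

Definition Vp : set 'cV[R]_n := [set x | A *m x = b].
Definition Vd : set 'cV[R]_n := [set c + A^T *m y | y in [set: 'cV[R]_m]].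
Definition Fp : set 'cV[R]_n := Vp `&` orthant.
Definition Fd : set 'cV[R]_n := Vd `&` orthant.

Definition Xopt : set 'cV[R]_n :=
  [set x | Fp x /\ forall u, Fp u -> dot c x <= dot c u].
Definition Yopt : set 'cV[R]_m :=
  [set y | orthant (c - A^T *m y) /\
           forall v, orthant (c - A^T *m v) -> dot b v <= dot b y].
Definition Sopt : set 'cV[R]_n :=
  [set s | Fd s /\ forall u, Fd u -> dot qvec (c - u) <= dot qvec (c - s)].

Definition LP_assumption : Prop :=
  [/\ Xopt !=set0, (Fp `\` Xopt) !=set0 & (Fd `\` Sopt) !=set0].

Definition Hp : set 'cV[R]_n :=
  [set x | exists2 xs, Xopt xs & dot c x = dot c xs].
Definition Hd : set 'cV[R]_n :=
  [set s | exists2 ss, Sopt ss & dot qvec (c - s) = dot qvec (c - ss)].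

Definition theta_p_star : R := theta_star Vp Xopt.
Definition theta_d_star : R := theta_star Vd Sopt.
Definition mu_p : R := sharpness Vp Hp Xopt.
Definition mu_d : R := sharpness Vd Hd Sopt.

Definition E_d (x s : 'cV[R]_n) : R := Num.max (Dist x Xopt) (Dist s Sopt).

Definition calN : R :=
  17%:R / 2%:R * kappa A * (mu_p^-1 + mu_d^-1) *
  (theta_p_star + theta_d_star
   + Dist 0 Xopt / Dist 0 Vp + Dist c Sopt / Dist 0 Vd).

Definition calD : R :=
  32%:R * expR 1 * kappa A * Num.max (enorm c / normQ) (normQ / enorm c).

Definition Lagr (x : 'cV[R]_n) (y : 'cV[R]_m) : R :=
  dot c x + dot b y - dot x (A^T *m y).

Definition Zopt : set ('cV[R]_n * 'cV[R]_m) := Xopt `*` Yopt.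

Section Algorithm.
Variables (tau sigma beta : R).

Definition PDHGstep (z : 'cV[R]_n * 'cV[R]_m) : 'cV[R]_n * 'cV[R]_m :=
  let x1 := proj orthant (z.1 - tau *: (c - A^T *m z.2)) in
  (x1, z.2 + sigma *: (b - A *m (2%:R *: x1 - z.1))).

Definition Mmx : 'M[R]_(n + m) :=
  block_mx (tau^-1)%:M (- A^T) (- A) (sigma^-1)%:M.

Definition normM (z : 'cV[R]_n * 'cV[R]_m) : R :=
  let v := col_mx z.1 z.2 in Num.sqrt (dot v (Mmx *m v)).

Definition gap (r : R) (z : 'cV[R]_n * 'cV[R]_m) : R :=
  r^-1 * sup [set Lagr z.1 w.2 - Lagr w.1 z.2
             | w in [set w : 'cV[R]_n * 'cV[R]_m
                     | orthant w.1 /\ normM (w - z) <= r]].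

(* State of the run while it is at (n, k) = (outer, inner): zprev, zstart and
   zcur are z^{n-1,0}, z^{n,0} and z^{n,k}, and zsum is the sum of z^{n,i} for
   1 <= i <= k.  While outer = 0 the field zprev is never used. *)
Record state := State {
  outer : nat;
  inner : nat;
  zprev : 'cV[R]_n * 'cV[R]_m;
  zstart : 'cV[R]_n * 'cV[R]_m;
  zcur : 'cV[R]_n * 'cV[R]_m;
  zsum : 'cV[R]_n * 'cV[R]_m
}.

Definition restart_cond (j k : nat)
    (zpv zst zbar : 'cV[R]_n * 'cV[R]_m) : Prop :=
  (j = 0%N /\ k = 1%N) \/
  ((1 <= j)%N /\
   gap (normM (zbar - zst)) zbar <= beta * gap (normM (zst - zpv)) zst).

Definition init_state (z0 : 'cV[R]_n * 'cV[R]_m) : state :=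
  State 0 0 z0 z0 z0 0.

(* Performs one call of PDHGstep, unless the method has stopped at a
   saddlepoint z^{n,0}. *)
Definition rPDHG_step (st : state) : state :=
  if `[< inner st = 0%N /\ Zopt (zstart st) >] then st
  else
    let k := (inner st).+1 in
    let z := PDHGstep (zcur st) in
    let zs := zsum st + z in
    let zbar := k%:R^-1 *: zs in
    if `[< restart_cond (outer st) k (zprev st) (zstart st) zbar >]
    then State (outer st).+1 0 (zstart st) zbar zbar 0
    else State (outer st) k (zprev st) (zstart st) z zs.

Definition rPDHG (z0 : 'cV[R]_n * 'cV[R]_m) (t : nat) : state :=
  iter t rPDHG_step (init_state z0).

(* After t iterations the run has just obtained a z^{n,0} whose distance to
   optima is at most eps. *)
Definition attains (z0 : 'cV[R]_n * 'cV[R]_m) (eps : R) (t : nat) : Prop :=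
  let st := rPDHG z0 t in
  inner st = 0%N /\
  E_d (zstart st).1 (c - A^T *m (zstart st).2) <= eps.

(* If the run stops at a saddlepoint then attains already holds there, so that
   all the steps counted by the least t are calls of PDHGstep. *)
Definition total_iterations (z0 : 'cV[R]_n * 'cV[R]_m) (eps : R) (t : nat)
    : Prop :=
  attains z0 eps t /\ forall u : nat, (u < t)%N -> ~ attains z0 eps u.

End Algorithm.
End LinearProgram.

(* Main.v *)
Require Import Defs.
From mathcomp Require Import all_boot all_order all_algebra.
From mathcomp Require Import all_classical all_reals all_analysis.
From mathcomp Require Import ring lra.
Import Order.TTheory GRing.Theory Num.Theory.
Import numFieldNormedType.Exports.
Local Open Scope classical_set_scope.
Local Open Scope ring_scope.
Set Implicit Arguments.
Unset Strict Implicit.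
Unset Printing Implicit Defensive.

(** The argument turns the normalized duality gap into an error bound, and the
    error bound into a length for the inner loops.

    Error bound.  As c lies in the null space of A, the primal minimizes c over
    (q + Null A) and the dual minimizes q over (c + Im A^T), both intersected
    with the orthant, and by strong duality (strong_duality, from Farkas) the
    two optimal values add up to 0.  Both problems thus fit one scheme: a linear
    function g minimized over V `&` orthant, where g is parallel to V.  In that
    scheme a point x of V whose distance to the orthant is d lies within
    theta * d of the feasible set, and there sharpness compares the distance to
    the optima with the excess of objective value.  The ratio theta_star is a
    limit at the optimal set; a contraction of x towards its nearest optimal
    point scales everything by the same factor, which makes the bound global
    (one_sided_error_bound).  Hoffman's bound (hoffman) is what makes the
    suprema and infima in theta_star and sharpness meaningful: it gives
    bounded error ratios and positive sharpness.  Testing the gap of z on a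
    dual shift, on a primal shift and on a multiple of z bounds the primal
    residual, the dual infeasibility and the objective gap by the normalized
    gap rho.  All this adds up to
      (weighted distance of z to the optima) <= (14/17) calN * rho
    for the restart points z of the method (weighted_error_le_gap).

    Inner loops.  A step is a proximal-point step for the metric step_norm 1,
    so that the average over k steps from z0 has a saddle gap of order 1/k and
    the iterates do not move away from any saddle point (step_descent,
    pdhg_avg_gap, pdhg_nonexpansive).  The norm normM that occurs in the
    normalized gap is step_norm (-1): its off-diagonal blocks have the opposite
    sign.  The step-sizes satisfy 4 tau sigma lam_max^2 = 1, so that the squares
    of the two norms are within a factor 3 of each other, and 7/4 >= sqrt 3
    bounds the ratio of the norms.  Hence after k steps rho is at most (21/4)/k
    times the distance of z0 to the saddle points (pdhg_gap_le), hence at most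
    (21/4) (14/17) calN / k times the gap at z0.  Since
    (21/4) (14/17) < 5, at most 5 e calN steps divide the gap by e (phase_next).

    Count.  The first inner loop has one step.  With l the logarithm in the
    statement, floor(l) further loops reduce the gap by the factor
    exp (- floor l), and the error bound shows that this makes E_d at most eps;
    the constant 32 e in calD absorbs the rounding of l and the conversion
    between weighted and unweighted distances (iteration_bound). *)

(** * Semi-inner products and the Euclidean norm *)

Section SemiInnerProduct.
Context {R : realType} {V : lmodType R} (B : V -> V -> R).
Hypothesis BDl : forall u v w, B (u + v) w = B u w + B v w.
Hypothesis BZl : forall a u w, B (a *: u) w = a * B u w.
Hypothesis BC : forall u v, B u v = B v u.
Hypothesis Bge0 : forall u, 0 <= B u u.

Lemma form_sqrD (u v : V) (t : R) :
  B (u + t *: v) (u + t *: v) = B u u + 2%:R * t * B u v + t ^+ 2 * B v v.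
Proof.
rewrite BDl BZl ![B _ (u + _)]BC !BDl !BZl [B v u]BC; ring.
Qed.

(** The form B need not be definite, so a vector v with B v v = 0 is treated
    apart: then B (u + t v) (u + t v) is affine in t, and B u v > 0 would
    make it negative for some t. *)
Lemma form_CauchySchwarz (u v : V) :
  B u v <= Num.sqrt (B u u) * Num.sqrt (B v v).
Proof.
have key (t : R) := Bge0 (u + t *: v).
set a := Num.sqrt (B u u); set d := Num.sqrt (B v v).
have a0 : 0 <= a := sqrtr_ge0 _.
have d0 : 0 <= d := sqrtr_ge0 _.
have aE : B u u = a ^+ 2 by rewrite sqr_sqrtr.
have dE : B v v = d ^+ 2 by rewrite sqr_sqrtr.
have [d_gt0|d_le0] := ltP 0 d.
  have := key (- (a / d)); rewrite form_sqrD aE dE.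
  have -> : a ^+ 2 + 2%:R * (- (a / d)) * B u v + (- (a / d)) ^+ 2 * d ^+ 2
    = 2%:R * (a / d) * (a * d - B u v) by field; rewrite gt_eqF.
  have [a_gt0|a_le0] := ltP 0 a.
    rewrite pmulr_rge0 ?subr_ge0// mulr_gt0// divr_gt0//.
  have a00 : a = 0 by apply/eqP; rewrite eq_le a_le0 a0.
  move=> _; rewrite a00 mul0r leNgt; apply/negP => Bp.
  have := key (- (B u v / d ^+ 2)); rewrite form_sqrD aE a00 dE.
  have -> : 0 ^+ 2 + 2%:R * (- (B u v / d ^+ 2)) * B u v
    + (- (B u v / d ^+ 2)) ^+ 2 * d ^+ 2 = - (B u v ^+ 2 / d ^+ 2).
    by field; rewrite gt_eqF.
  by rewrite oppr_ge0 leNgt divr_gt0// exprn_gt0.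
have d00 : d = 0 by apply/eqP; rewrite eq_le d_le0 d0.
rewrite d00 mulr0 leNgt; apply/negP => Bp.
have := key (- ((a ^+ 2 + 1) / (2%:R * B u v))); rewrite form_sqrD aE dE d00.
have -> : a ^+ 2 + 2%:R * (- ((a ^+ 2 + 1) / (2%:R * B u v))) * B u v
   + (- ((a ^+ 2 + 1) / (2%:R * B u v))) ^+ 2 * 0 ^+ 2 = - 1.
  by field; rewrite gt_eqF.
by lra.
Qed.

Lemma form_triangle (u v : V) :
  Num.sqrt (B (u + v) (u + v)) <= Num.sqrt (B u u) + Num.sqrt (B v v).
Proof.
rewrite -(ler_pXn2r (n := 2)) ?nnegrE ?addr_ge0 ?sqrtr_ge0//.
rewrite sqr_sqrtr// -[X in B (u + X) _]scale1r -[X in B _ (u + X)]scale1r.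
rewrite form_sqrD sqrrD !sqr_sqrtr//.
have := form_CauchySchwarz u v; lra.
Qed.

Lemma form_normZ (a : R) (u : V) :
  Num.sqrt (B (a *: u) (a *: u)) = `|a| * Num.sqrt (B u u).
Proof. by rewrite BZl BC BZl mulrA -expr2 sqrtrM ?sqr_ge0// sqrtr_sqr. Qed.

End SemiInnerProduct.

Section Dot.
Context {R : realType}.
Implicit Types n m : nat.

Lemma dotE n (u v : 'cV[R]_n) : dot u v = \sum_i u i 0 * v i 0.
Proof. by rewrite /dot mxE; apply: eq_bigr => i _; rewrite mxE. Qed.

Lemma dotC n (u v : 'cV[R]_n) : dot u v = dot v u.
Proof. by rewrite !dotE; apply: eq_bigr => i _; rewrite mulrC. Qed.

Lemma dotDl n (u v w : 'cV[R]_n) : dot (u + v) w = dot u w + dot v w.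
Proof. by rewrite /dot linearD mulmxDl mxE. Qed.

Lemma dotZl n a (u w : 'cV[R]_n) : dot (a *: u) w = a * dot u w.
Proof. by rewrite /dot linearZ -scalemxAl mxE. Qed.

Lemma dotDr n (u v w : 'cV[R]_n) : dot w (u + v) = dot w u + dot w v.
Proof. by rewrite dotC dotDl !(dotC _ w). Qed.

Lemma dotZr n a (u w : 'cV[R]_n) : dot w (a *: u) = a * dot w u.
Proof. by rewrite dotC dotZl dotC. Qed.

Lemma dotNl n (u w : 'cV[R]_n) : dot (- u) w = - dot u w.
Proof. by rewrite -scaleN1r dotZl mulN1r. Qed.

Lemma dotNr n (u w : 'cV[R]_n) : dot w (- u) = - dot w u.
Proof. by rewrite dotC dotNl dotC. Qed.

Lemma dotBl n (u v w : 'cV[R]_n) : dot (u - v) w = dot u w - dot v w.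
Proof. by rewrite dotDl dotNl. Qed.

Lemma dotBr n (u v w : 'cV[R]_n) : dot w (u - v) = dot w u - dot w v.
Proof. by rewrite dotDr dotNr. Qed.

Lemma dot0l n (w : 'cV[R]_n) : dot 0 w = 0.
Proof. by rewrite -(scale0r (0 : 'cV[R]_n)) dotZl mul0r. Qed.

Lemma dot0r n (w : 'cV[R]_n) : dot w 0 = 0.
Proof. by rewrite dotC dot0l. Qed.

Lemma dot_mulmxr m n (A : 'M[R]_(m, n)) (y : 'cV[R]_m) (x : 'cV[R]_n) :
  dot x (A^T *m y) = dot y (A *m x).
Proof. by rewrite dotC /dot trmx_mul trmxK mulmxA. Qed.

Lemma dot_ge0 n (u : 'cV[R]_n) : 0 <= dot u u.
Proof. by rewrite dotE sumr_ge0// => i _; rewrite -expr2 sqr_ge0. Qed.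

Lemma dot_eq0 n (u : 'cV[R]_n) : dot u u = 0 -> u = 0.
Proof.
rewrite dotE => /psumr_eq0P H; apply/matrixP => i j; rewrite (ord1 j) mxE.
have /eqP := H (fun i _ => sqr_ge0 (u i 0)) i isT.
by rewrite mulf_eq0 => /orP[]/eqP.
Qed.

Lemma enorm_ge0 n (u : 'cV[R]_n) : 0 <= enorm u.
Proof. exact: sqrtr_ge0. Qed.

Lemma enorm_sqr n (u : 'cV[R]_n) : enorm u ^+ 2 = dot u u.
Proof. by rewrite sqr_sqrtr// dot_ge0. Qed.

Lemma enorm0 n : enorm (0 : 'cV[R]_n) = 0.
Proof. by rewrite /enorm dot0l sqrtr0. Qed.

Lemma enorm_eq0 n (u : 'cV[R]_n) : enorm u = 0 -> u = 0.
Proof. by move=> u0; apply: dot_eq0; rewrite -enorm_sqr u0 expr0n. Qed.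

Lemma enorm_gt0 n (u : 'cV[R]_n) : u <> 0 -> 0 < enorm u.
Proof.
move=> u0; rewrite lt_neqAle enorm_ge0 andbT eq_sym.
by apply/negP => /eqP/enorm_eq0.
Qed.

Lemma dot_le_enorm n (u v : 'cV[R]_n) : dot u v <= enorm u * enorm v.
Proof.
by apply: (@form_CauchySchwarz R _ (@dot R n));
  [exact: dotDl|exact: dotZl|exact: dotC|exact: dot_ge0].
Qed.

Lemma enormD n (u v : 'cV[R]_n) : enorm (u + v) <= enorm u + enorm v.
Proof.
by apply: (@form_triangle R _ (@dot R n));
  [exact: dotDl|exact: dotZl|exact: dotC|exact: dot_ge0].
Qed.

Lemma enormZ n a (u : 'cV[R]_n) : enorm (a *: u) = `|a| * enorm u.
Proof. by apply: (@form_normZ R _ (@dot R n)); [exact: dotZl|exact: dotC]. Qed.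

Lemma enormN n (u : 'cV[R]_n) : enorm (- u) = enorm u.
Proof. by rewrite -scaleN1r enormZ normrN1 mul1r. Qed.

Lemma enormB n (u v : 'cV[R]_n) : enorm (u - v) = enorm (v - u).
Proof. by rewrite -enormN opprB. Qed.

Lemma enorm_le n (u v : 'cV[R]_n) : dot u u <= dot v v -> enorm u <= enorm v.
Proof. by move=> uv; rewrite ler_sqrt// dot_ge0. Qed.

Lemma entry_le_enorm n (u : 'cV[R]_n) i : `|u i 0| <= enorm u.
Proof.
rewrite -(ler_pXn2r (n := 2)) ?nnegrE ?enorm_ge0// enorm_sqr dotE.
rewrite (bigD1 i)//= -normrX ger0_norm ?sqr_ge0// expr2 lerDl sumr_ge0// => j _.
by rewrite -expr2 sqr_ge0.
Qed.

Lemma dot_sqrB n (u v : 'cV[R]_n) (t : R) :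
  dot (u - t *: v) (u - t *: v) =
  dot u u - 2%:R * t * dot u v + t ^+ 2 * dot v v.
Proof. rewrite dotBl !dotBr !dotZl !dotZr (dotC v u); ring. Qed.

End Dot.

Section Distance.
Context {R : realType} {n : nat}.
Implicit Types (u v w : 'cV[R]_n) (C : set 'cV[R]_n).

Lemma Dist_ge0 v C : 0 <= Dist v C.
Proof.
rewrite /Dist; have [->|C0] := eqVneq C set0.
  by rewrite image_set0 inf0.
apply: lb_le_inf; first by apply: image_nonempty; apply/set0P.
by move=> _ [w _ <-]; exact: enorm_ge0.
Qed.

Lemma Dist_le v w C : C w -> Dist v C <= enorm (v - w).
Proof.
move=> Cw; apply: ge_inf; last by exists w.
by exists 0 => _ [u _ <-]; exact: enorm_ge0.
Qed.

Lemma Dist_mem0 v C : C v -> Dist v C = 0.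
Proof.
move=> Cv; apply/eqP; rewrite eq_le Dist_ge0 andbT.
by rewrite -(@enorm0 R n) -(subrr v) Dist_le.
Qed.

Lemma le_Dist v C a : C !=set0 -> (forall w, C w -> a <= enorm (v - w)) ->
  a <= Dist v C.
Proof.
move=> C0 H; apply: lb_le_inf; first exact: image_nonempty.
by move=> _ [w Cw <-]; exact: H.
Qed.

Lemma Dist_proj v w C : is_proj C v w -> Dist v C = enorm (v - w).
Proof.
move=> [Cw H]; apply/eqP; rewrite eq_le Dist_le//=.
by apply: le_Dist => //; exists w.
Qed.

Lemma Dist_triangle v w C : C !=set0 -> Dist v C <= enorm (v - w) + Dist w C.
Proof.
move=> C0; rewrite -lerBlDl; apply: le_Dist => // u Cu.
rewrite lerBlDl (le_trans (Dist_le v Cu))// -(subrKA w).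
exact: enormD.
Qed.

End Distance.

(** * Compactness and nearest points *)

Section Compactness.
Context {R : realType} {n : nat}.
Implicit Types (u v w : 'cV[R]_n) (S : set 'cV[R]_n).

Lemma continuous_entry (i : 'I_n) : continuous (fun u => u i 0).
Proof. exact: coord_continuous. Qed.

Lemma continuous_dotr w : continuous (fun u => dot w u).
Proof.
have -> : (fun u => dot w u) = (fun u => \sum_i w i 0 * u i 0).
  by apply/funext => u; rewrite dotE.
apply: (@continuous_big R _ +%R 0 xpredT (@add_continuous R^o)) => i _.
move=> u; apply: (@cvgM _ _ (nbhs u) _ (fun=> w i 0) (fun u => u i 0)).
  exact: cvg_cst.
exact: continuous_entry.
Qed.

Lemma mulmx_row_dot m (B : 'M[R]_(m, n)) u i :
  (B *m u) i 0 = dot ((row i B)^T) u.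
Proof. by rewrite dotE mxE; apply: eq_bigr => j _; rewrite !mxE. Qed.

Lemma continuous_sqr_dist m (B : 'M[R]_(m, n)) (w : 'cV[R]_m) :
  continuous (fun u => dot (B *m u - w) (B *m u - w)).
Proof.
have -> : (fun u => dot (B *m u - w) (B *m u - w)) =
    (fun u => \sum_i (dot ((row i B)^T) u - w i 0) *
                     (dot ((row i B)^T) u - w i 0)).
  apply/funext => u; rewrite dotE; apply: eq_bigr => i _.
  by rewrite -mulmx_row_dot !mxE.
apply: (@continuous_big R _ +%R 0 xpredT (@add_continuous R^o)) => i _.
pose f u := dot ((row i B)^T) u - w i 0.
have H : continuous f.
  move=> u; apply: (@cvgB _ _ _ (nbhs u) _ _ (fun=> w i 0)).
    exact: continuous_dotr.
  exact: cvg_cst.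
by move=> u; apply: (@cvgM _ _ (nbhs u) _ f f); exact: H.
Qed.

Lemma closed_level (f : 'cV[R]_n -> R) a : continuous f ->
  closed [set u | f u <= a].
Proof.
move=> cf; apply: (@closed_comp _ _ f [set x | x <= a]).
  by move=> u _; exact: cf.
exact: closed_le.
Qed.

Lemma closed_level_eq (f : 'cV[R]_n -> R) a : continuous f ->
  closed [set u | f u = a].
Proof.
move=> cf; apply: (@closed_comp _ _ f [set x | x = a]).
  by move=> u _; exact: cf.
exact: closed_eq.
Qed.

Lemma closed_orthant : closed (@orthant R n).
Proof.
have -> : @orthant R n = \bigcap_(i in [set: 'I_n]) [set u | 0 <= u i 0].
  by apply/seteqP; split=> [u uo i _ /=|u uo i]; [exact: uo|exact: (uo i I)].
apply: closed_bigI => i _.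
apply: (@closed_comp _ _ (fun u : 'cV[R]_n => u i 0) [set x | 0 <= x]).
  by move=> u _; exact: continuous_entry.
exact: closed_ge.
Qed.

Lemma closed_affine m (B : 'M[R]_(m, n)) (d : 'cV[R]_m) :
  closed [set u | B *m u = d].
Proof.
have -> : [set u | B *m u = d] =
    \bigcap_(i in [set: 'I_m]) [set u | dot ((row i B)^T) u = d i 0].
  apply/seteqP; split=> [u /= uo i _ /=|u uo /=];
    first by rewrite -mulmx_row_dot uo.
  by apply/matrixP => i j; rewrite (ord1 j) mulmx_row_dot; exact: uo.
by apply: closed_bigI => i _; apply: closed_level_eq; exact: continuous_dotr.
Qed.

(** The compactness of bounded closed sets of row vectors carries over to
    column vectors, since transposition is continuous. *)
Lemma compact_bounded_closed S M : closed S ->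
  (forall u, S u -> enorm u <= M) -> compact S.
Proof.
move=> cS bS.
pose f (x : 'rV[R]_n) : 'cV[R]_n := x^T.
have cf : continuous f.
  move=> x W /nbhs_ballP[e e0 eW]; apply/nbhs_ballP; exists e => // y [_ xy].
  by apply: eW; split=> // i j; rewrite !mxE; exact: xy.
have -> : S = f @` (f @^-1` S).
  apply/seteqP; split=> [u Su|_ [x Sx <-]//].
  by exists u^T; rewrite /f /= trmxK.
apply: continuous_compact; first exact: continuous_subspaceT.
apply: bounded_closed_compact; last exact: closed_comp.
exists M; split; first exact: num_real.
move=> K MK x /= Sx; rewrite [leLHS]/Num.Def.normr/= mx_normrE.
apply/bigmax_leP; split=> [|[i j] _ /=].
  by apply: le_trans (ltW MK); exact: le_trans (enorm_ge0 _) (bS _ Sx).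
have := entry_le_enorm (f x) j; rewrite mxE (ord1 i) => /le_trans; apply.
exact: le_trans (bS _ Sx) (ltW MK).
Qed.

Lemma attained_min S (f : 'cV[R]_n -> R) M : closed S -> S !=set0 ->
  (forall u, S u -> enorm u <= M) -> continuous f ->
  exists2 w, S w & forall u, S u -> f w <= f u.
Proof.
move=> cS S0 bS cf.
have [w] := compact_EVT_min S0 (compact_bounded_closed cS bS)
  (continuous_subspaceT cf).
rewrite inE => Sw H; exists w => // u Su; apply: H; exact/mem_set.
Qed.

(** Only the points that are not farther from v than some given u0 matter,
    and they form a compact set. *)
Lemma nearest_point S v : closed S -> S !=set0 -> exists w, is_proj S v w.
Proof.
move=> cS [u0 Su0].
have sqdist_continuous : continuous (fun u => dot (u - v) (u - v)).
  have := @continuous_sqr_dist n 1%:M v.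
  by under eq_fun do rewrite !mul1mx.
pose S' := S `&` [set u | dot (u - v) (u - v) <= dot (u0 - v) (u0 - v)].
have [||||w [Sw wu0] wmin] :=
  @attained_min S' (fun u => dot (u - v) (u - v)) (enorm (u0 - v) + enorm v).
- by apply: closedI => //; apply: closed_level; exact: sqdist_continuous.
- by exists u0; split => /=.
- move=> u [_ /= /enorm_le H]; rewrite -{1}(subrK v u).
  by apply: le_trans (enormD _ _) _; rewrite lerD2r.
- exact: sqdist_continuous.
exists w; split=> // u Su; rewrite enormB (enormB v u); apply: enorm_le.
have [uu0|/ltW u0u] := leP (dot (u - v) (u - v)) (dot (u0 - v) (u0 - v)).
  exact: wmin.
exact: le_trans wu0 u0u.
Qed.

End Compactness.

(** * Pseudo-inverses and singular values *)

Section LinearAlgebra.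
Context {R : realType}.

Lemma le_of_sqr_le (x y : R) : 0 <= y -> x ^+ 2 <= y ^+ 2 -> x <= y.
Proof.
move=> y0; rewrite -subr_ge0 subr_sqr => H; rewrite leNgt; apply/negP => xy.
move: H; rewrite leNgt nmulr_rlt0 ?subr_lt0// ltr_wpDl//.
exact: le_lt_trans xy.
Qed.

Lemma gram_unit m n (F : 'M[R]_(m, n)) : row_free F -> F *m F^T \in unitmx.
Proof.
move=> rF; rewrite -row_free_unit; apply: inj_row_free => v vFF.
apply: (row_free_inj rF); rewrite mul0mx; apply: trmx_inj; rewrite trmx0.
apply: dot_eq0; rewrite /dot trmxK trmx_mul -mulmxA (mulmxA F) mulmxA.
by rewrite mulmxA -(mulmxA v) vFF mul0mx mxE.
Qed.

(** If B = C F is a full-rank factorization, then the pseudo-inverse of B is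
    F^T (F F^T)^-1 (C^T C)^-1 C^T. *)
Lemma pinv_exists m n (B : 'M[R]_(m, n)) : exists G, is_pinv B G.
Proof.
have [r [C [F [-> rC rF]]]] : exists r (C : 'M[R]_(m, r)) (F : 'M[R]_(r, n)),
    [/\ B = C *m F, row_full C & row_free F].
  exists (\rank B), (col_base B), (row_base B).
  by rewrite mulmx_base col_base_full row_base_free.
pose X := invmx (F *m F^T); pose Y := invmx (C^T *m C).
have uX : F *m F^T \in unitmx by apply: gram_unit.
have uY : C^T *m C \in unitmx.
  rewrite -[X in _ *m X]trmxK; apply: gram_unit.
  by rewrite /row_free mxrank_tr.
have XK : F *m (F^T *m X) = 1%:M by rewrite mulmxA mulmxV.
have YK : Y *m C^T *m C = 1%:M by rewrite -mulmxA mulVmx.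
have sX : X^T = X by rewrite trmx_inv trmx_mul trmxK.
have sY : Y^T = Y by rewrite trmx_inv trmx_mul trmxK.
exists ((F^T *m X) *m (Y *m C^T)).
have BG : C *m F *m (F^T *m X *m (Y *m C^T)) = C *m (Y *m C^T).
  by rewrite mulmxA -(mulmxA C) XK mulmx1.
have GB : F^T *m X *m (Y *m C^T) *m (C *m F) = F^T *m X *m F.
  by rewrite mulmxA -(mulmxA (F^T *m X)) YK mulmx1.
split.
- by rewrite BG -(mulmxA C) (mulmxA (Y *m C^T)) YK mul1mx.
- by rewrite GB mulmxA -(mulmxA (F^T *m X) F) XK mulmx1.
- by rewrite BG !trmx_mul trmxK sY mulmxA.
- by rewrite GB !trmx_mul trmxK sX mulmxA.
Qed.

Lemma pinvP m n (B : 'M[R]_(m, n)) : is_pinv B (Defs.pinv B).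
Proof. by have [G HG] := pinv_exists B;
  exact: (@xgetPex _ 0 (is_pinv B) (ex_intro _ G HG)). Qed.

(** A A^T pinv (A A^T) is the orthogonal projection onto the range of A: the
    difference D of the two sides satisfies D A^T = 0, hence D D^T = 0. *)
Lemma gram_pinvK m n (A : 'M[R]_(m, n)) :
  A *m A^T *m Defs.pinv (A *m A^T) *m A = A.
Proof.
have [H _ _ _] := pinvP (A *m A^T).
set G := Defs.pinv _ in H *.
pose D := A *m A^T *m G *m A - A.
have DA : D *m A^T = 0 by rewrite mulmxBl -(mulmxA _ A) H subrr.
apply/eqP; rewrite -subr_eq0 -/D; apply/eqP.
have DD : D *m D^T = 0.
  by rewrite {2}/D linearB/= trmx_mul mulmxBr mulmxA DA mul0mx subrr.
apply/row_matrixP => i; apply: trmx_inj; rewrite row0 trmx0; apply: dot_eq0.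
rewrite /dot trmxK; have /matrixP/(_ i i) := DD.
rewrite !mxE => DDi; apply: etrans DDi.
by apply: eq_bigr => j _; rewrite !mxE.
Qed.

(** The columns of cokermx K lie in the null space of K, and g^T is in the
    row space of K as soon as it annihilates them. *)
Lemma orth_null_row m n (K : 'M[R]_(m, n)) (g : 'cV[R]_n) :
  (forall x, K *m x = 0 -> dot g x = 0) -> exists y, g = K^T *m y.
Proof.
move=> H; have /submxP[D gE] : (g^T <= K)%MS.
  rewrite submxE; apply/eqP/row_matrixP => i; apply/rowP => j.
  rewrite (ord1 i) !mxE.
  have Kc : K *m col j (cokermx K) = 0.
    by rewrite colE mulmxA mulmx_coker mul0mx.
  apply: etrans (H _ Kc); rewrite dotE.
  by apply: eq_bigr => k _; rewrite !mxE.
by exists D^T; rewrite -trmx_mul -gE trmxK.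
Qed.

Lemma row_space_null m n (A : 'M[R]_(m, n)) (u : 'cV[R]_n) :
  (cokermx A)^T *m u = 0 <-> exists y, u = A^T *m y.
Proof.
split=> [u0|[y ->]].
  have /submxP[D uE] : (u^T <= A)%MS.
    rewrite submxE; apply/eqP; apply: trmx_inj.
    by rewrite trmx_mul trmxK u0 trmx0.
  by exists D^T; rewrite -trmx_mul -uE trmxK.
by rewrite mulmxA -trmx_mul mulmx_coker trmx0 mul0mx.
Qed.

End LinearAlgebra.

Section SingularValues.
Context {R : realType} {m n : nat} (A : 'M[R]_(m, n)).
Let f (u : 'cV[R]_n) := dot (A *m u) (A *m u).

Lemma quadratic_ge0_linear0 (a b : R) :
  (forall t, 0 <= t * a + t ^+ 2 * b) -> a = 0.
Proof.
move=> H; apply/eqP; apply/negP => /negP a0.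
pose d := `|b| + 1.
have d0 : 0 < d by rewrite ltr_wpDl.
have := H (- (a / d)).
have -> : - (a / d) * a + (- (a / d)) ^+ 2 * b = - (a ^+ 2 / d ^+ 2 * (d - b)).
  by field; rewrite gt_eqF.
rewrite oppr_ge0 leNgt mulr_gt0//.
  by apply: divr_gt0; [rewrite exprn_even_gt0|exact: exprn_gt0].
by rewrite subr_gt0 /d ltr_pwDr// ler_norm.
Qed.

(** The extrema of |A u| on the unit sphere of a subspace {u | K u = 0} that
    A^T A preserves are attained at eigenvectors of A^T A, since the first
    variation vanishes there. The minimum is obtained for e = 1, the maximum
    for e = -1. *)
Lemma extremal_eigenvector p (K : 'M[R]_(p, n)) (e : R) : e <> 0 ->
  (forall u : 'cV[R]_n, K *m u = 0 -> K *m (A^T *m (A *m u)) = 0) ->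
  (exists2 u : 'cV[R]_n, K *m u = 0 & u <> 0) ->
  exists w, [/\ K *m w = 0, dot w w = 1, A^T *m (A *m w) = f w *: w &
    forall u, K *m u = 0 -> e * (f w * dot u u) <= e * f u].
Proof.
move=> en KA [u0 Ku0 u0n].
have scale1 u : u <> 0 -> dot ((enorm u)^-1 *: u) ((enorm u)^-1 *: u) = 1.
  move=> un; have ep := enorm_gt0 un.
  by rewrite dotZl dotZr -enorm_sqr; field; rewrite gt_eqF.
pose S := [set u | K *m u = 0] `&` [set u | dot (1%:M *m u - 0) (1%:M *m u - 0)
  = 1].
have [||||w [Kw w1] wmin] := @attained_min R n S (fun u => e * f u) 1.
- apply: closedI; first exact: closed_affine.
  by apply: closed_level_eq; exact: continuous_sqr_dist.
- exists ((enorm u0)^-1 *: u0); split=> /=;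
    first by rewrite -scalemxAr Ku0 scaler0.
  by rewrite mul1mx subr0 scale1.
- by move=> u [_ /=]; rewrite mul1mx subr0 /enorm => ->; rewrite sqrtr1.
- move=> u; apply: (@cvgM _ _ (nbhs u) _ (fun=> e) f); first exact: cvg_cst.
  have fE : f = (fun u => dot (A *m u - 0) (A *m u - 0)).
    by apply/funext => v; rewrite subr0.
  by rewrite fE; exact: continuous_sqr_dist.
move: w1; rewrite /= mul1mx subr0 => w1.
have wmin' u : K *m u = 0 -> e * (f w * dot u u) <= e * f u.
  move=> Ku; have [->|/eqP un] := eqVneq u 0.
    by rewrite /f mulmx0 !dot0l !mulr0.
  have ep := enorm_gt0 un.
  have := wmin ((enorm u)^-1 *: u).
  have -> : f ((enorm u)^-1 *: u) = (enorm u)^-1 ^+ 2 * f u.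
    by rewrite /f -scalemxAr dotZl dotZr mulrA expr2.
  rewrite -enorm_sqr => H; rewrite -(ler_pM2r (_ : 0 < (enorm u)^-1 ^+ 2)).
    have -> : e * (f w * enorm u ^+ 2) * (enorm u)^-1 ^+ 2 = e * f w.
      by field; rewrite gt_eqF.
    rewrite -mulrA (mulrC (f u)); apply: H; split=> /=.
      by rewrite -scalemxAr Ku scaler0.
    by rewrite mul1mx subr0 scale1.
  by rewrite exprn_gt0// invr_gt0.
exists w; split=> //.
have var u : K *m u = 0 -> dot (A *m w) (A *m u) = f w * dot w u.
  move=> Ku; apply/eqP; rewrite -subr_eq0; apply/eqP.
  have -> : dot (A *m w) (A *m u) - f w * dot w u =
    (2%:R * e)^-1 * (2%:R * e * (dot (A *m w) (A *m u) - f w * dot w u)).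
    by field; apply/eqP.
  rewrite (@quadratic_ge0_linear0 (2%:R * e * (dot (A *m w) (A *m u) - f w *
    dot w u))
    (e * (f u - f w * dot u u))) ?mulr0// => t.
  have /wmin' : K *m (w + t *: u) = 0 by rewrite mulmxDr -scalemxAr Kw Ku
    scaler0 addr0.
  rewrite -subr_ge0 /f mulmxDr -scalemxAr !dotDl !dotDr !dotZl !dotZr w1.
  rewrite (dotC u w) (dotC (A *m u) (A *m w)).
  by congr (_ <= _); ring.
apply/eqP; rewrite -subr_eq0; apply/eqP; set r := _ - _.
have Kr : K *m r = 0 by rewrite mulmxBr KA// -scalemxAr Kw scaler0 subrr.
apply: dot_eq0; rewrite {1}/r dotBl dotZl.
by rewrite (dotC (A^T *m _) r) dot_mulmxr var// subrr.
Qed.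

Hypothesis A0 : A <> 0.

Let row_sp (u : 'cV[R]_n) := exists y, u = A^T *m y.

Lemma row_space_nonzero : exists2 u, row_sp u & u <> 0.
Proof.
apply: contrapT => H; apply: A0; apply: trmx_inj; rewrite trmx0.
apply/matrixP => i j; apply: contrapT => Aij; apply: H.
exists (A^T *m delta_mx j 0); first by exists (delta_mx j 0).
move=> /matrixP/(_ i 0); rewrite -colE => H.
by apply: Aij; move: H; rewrite !mxE.
Qed.

Lemma eigenvalue_gram (u : 'cV[R]_n) (l : R) : u <> 0 ->
  A^T *m (A *m u) = l *: u -> eigenvalue (A^T *m A) l.
Proof.
move=> un uE; apply/eigenvalueP; exists u^T.
  apply: trmx_inj; rewrite !trmx_mul !trmxK -mulmxA uE.
  by rewrite linearZ/= trmxK.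
by apply/eqP => u0; apply: un; apply: trmx_inj; rewrite u0 trmx0.
Qed.

Lemma nz_sing_valP (l : R) : nz_sing_vals A l ->
  exists u, [/\ 0 < l, u <> 0, row_sp u & f u = l ^+ 2 * dot u u].
Proof.
move=> [l0 /eigenvalueP[v vE vn]]; exists v^T.
have vE' : A^T *m (A *m v^T) = l ^+ 2 *: v^T.
  by rewrite mulmxA -[A in X in X *m _]trmxK -trmx_mul trmxK -trmx_mul
    -linearZ/= -vE.
split=> //.
- by move=> v0; move/eqP: vn; apply; apply: trmx_inj; rewrite v0 trmx0.
- exists ((l ^+ 2)^-1 *: (A *m v^T)).
  rewrite -scalemxAr vE' scalerA mulVf ?scale1r//.
  by rewrite expf_neq0// gt_eqF.
- by rewrite /f -dot_mulmxr dotC vE' dotZl.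
Qed.

(** The minimum of |A u| over the unit sphere of the row space is positive,
    is a singular value, and bounds the other nonzero ones from below, since
    the eigenvectors for nonzero eigenvalues of A^T A lie in the row space. *)
Lemma lam_min_spec : 0 < lam_min A /\
  forall u, row_sp u -> lam_min A * enorm u <= enorm (A *m u).
Proof.
have [|||w [Kw w1 wE]] := @extremal_eigenvector _ (cokermx A)^T 1.
- by apply/eqP; exact: oner_neq0.
- by move=> u _; apply/row_space_null; exists (A *m u).
- have [u /row_space_null rsu un] := row_space_nonzero.
  by exists u.
- move=> wmin.
  have [y wy] : row_sp w by apply/row_space_null.
  have fw0 : 0 < f w.
    rewrite /f -enorm_sqr exprn_gt0// enorm_gt0// => Aw0.
    suff : dot w w = 0 by rewrite w1 => /eqP; rewrite oner_eq0.
    by rewrite {2}wy dot_mulmxr Aw0 dot0r.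
  have sfw0 : 0 < Num.sqrt (f w) by rewrite sqrtr_gt0.
  have lb l : nz_sing_vals A l -> Num.sqrt (f w) <= l.
    move=> /nz_sing_valP[u [l0 un rsu fu]].
    apply: le_of_sqr_le; first exact: ltW.
    rewrite sqr_sqrtr; last exact: ltW.
    have du : 0 < dot u u by rewrite -enorm_sqr exprn_gt0// enorm_gt0.
    rewrite -(ler_pM2r du) -fu.
    by have := wmin u; rewrite !mul1r; apply; apply/row_space_null.
  have mem : nz_sing_vals A (Num.sqrt (f w)).
    split=> //; rewrite sqr_sqrtr; last exact: ltW.
    apply: (eigenvalue_gram _ wE) => w0.
    by move: w1; rewrite w0 dot0l => /eqP; rewrite eq_sym oner_eq0.
  have lE : lam_min A = Num.sqrt (f w).
    apply/eqP; rewrite eq_le; apply/andP; split.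
      by apply: ge_inf => //; exists (Num.sqrt (f w)) => l /lb.
    by apply: lb_le_inf => [|l /lb//]; exists (Num.sqrt (f w)).
  rewrite lE; split=> // u rsu.
  rewrite -sqrtrM; last exact: ltW.
  rewrite ler_sqrt ?dot_ge0//.
  by have := wmin u; rewrite !mul1r; apply; apply/row_space_null.
Qed.

Lemma lam_max_spec u : enorm (A *m u) <= lam_max A * enorm u.
Proof.
have [|||w [_ w1 wE]] := @extremal_eigenvector 0 0 (- 1).
- by apply/eqP; rewrite oppr_eq0 oner_neq0.
- by move=> v _; rewrite mul0mx.
- have [v _ vn] := row_space_nonzero.
  by exists v => //; rewrite mul0mx.
- move=> wmax'.
  have wmax v : f v <= f w * dot v v.
    by have := wmax' v (mul0mx _ _); rewrite !mulN1r lerN2.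
  have fw0 : 0 < f w.
    have [v rsv vn] := row_space_nonzero.
    have dv : 0 < dot v v by rewrite -enorm_sqr exprn_gt0// enorm_gt0.
    rewrite -(pmulr_lgt0 _ dv) (lt_le_trans _ (wmax v))//.
    have [l0 /(_ v rsv) lv] := lam_min_spec.
    rewrite /f -enorm_sqr exprn_gt0// (lt_le_trans _ lv)//.
    by rewrite mulr_gt0// enorm_gt0.
  have ub l : nz_sing_vals A l -> l <= Num.sqrt (f w).
    move=> /nz_sing_valP[v [l0 vn _ fv]].
    apply: le_of_sqr_le; first exact: sqrtr_ge0.
    rewrite sqr_sqrtr; last exact: ltW.
    have dv : 0 < dot v v by rewrite -enorm_sqr exprn_gt0// enorm_gt0.
    by rewrite -(ler_pM2r dv) -fv.
  have mem : nz_sing_vals A (Num.sqrt (f w)).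
    split; first by rewrite sqrtr_gt0.
    rewrite sqr_sqrtr; last exact: ltW.
    apply: (eigenvalue_gram _ wE) => w0.
    by move: w1; rewrite w0 dot0l => /eqP; rewrite eq_sym oner_eq0.
  have lE : Num.sqrt (f w) <= lam_max A.
    by apply: ub_le_sup => //; exists (Num.sqrt (f w)) => l /ub.
  apply: (@le_trans _ _ (Num.sqrt (f w) * enorm u)).
    rewrite -sqrtrM; last exact: ltW.
    rewrite ler_sqrt; first exact: wmax.
    by apply: mulr_ge0; [exact: ltW|exact: dot_ge0].
  by rewrite ler_wpM2r// enorm_ge0.
Qed.

Lemma lam_min_le_max : lam_min A <= lam_max A.
Proof.
have [u rsu un] := row_space_nonzero.
rewrite -(ler_pM2r (enorm_gt0 un)).
by have [_ /(_ u rsu) /le_trans] := lam_min_spec; apply; exact: lam_max_spec.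
Qed.

(** The nonzero singular values of A^T are those of A; here v = A u with u in
    the row space, and |v|^2 = (A^T v) . u. *)
Lemma lam_min_tr (v : 'cV[R]_m) : (exists x, v = A *m x) ->
  lam_min A * enorm v <= enorm (A^T *m v).
Proof.
move=> [x vx]; have [l0 lP] := lam_min_spec.
pose u := A^T *m (Defs.pinv (A *m A^T) *m v).
have vu : A *m u = v by rewrite /u !mulmxA vx (mulmxA _ A) gram_pinvK.
have := lP u (ex_intro _ _ erefl); rewrite vu => lu.
have [->|/eqP vn] := eqVneq v 0; first by rewrite mulmx0 !enorm0 mulr0.
have vp := enorm_gt0 vn.
have H : enorm v ^+ 2 <= enorm (A^T *m v) * enorm u.
  by rewrite enorm_sqr -{2}vu -dot_mulmxr dotC dot_le_enorm.
rewrite -(ler_pM2r vp) -mulrA -expr2.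
apply: le_trans (_ : lam_min A * (enorm (A^T *m v) * enorm u) <= _).
  by rewrite ler_pM2l.
by rewrite mulrCA ler_wpM2l// enorm_ge0.
Qed.

End SingularValues.

(** * Farkas' lemma and optimality conditions *)

Section Farkas.
Context {R : realType} {n p : nat} (K : 'M[R]_(p, n)).

(** Bartl's induction on the number of inequalities: if the last inequality
    is not redundant, some x0 violates it alone and has dot g x0 > 0;
    subtracting multiples of a k from g and from the other a i makes them all
    vanish at x0 and reduces the claim to k inequalities. *)
Lemma farkas k (a : nat -> 'cV[R]_n) (g : 'cV[R]_n) :
  (forall x, K *m x = 0 -> (forall i, (i < k)%N -> dot (a i) x <= 0) ->
    dot g x <= 0) ->
  exists (l : nat -> R) (y : 'cV[R]_p), (forall i, (i < k)%N -> 0 <= l i) /\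
    g = \sum_(i < k) l i *: a i + K^T *m y.
Proof.
elim: k a g => [|k IH] a g H.
  have [x Kx|y ->] := @orth_null_row _ _ _ K g.
    apply/eqP; rewrite eq_le H//= -oppr_le0 -dotNr.
    by apply: H => //; rewrite mulmxN Kx oppr0.
  by exists (fun=> 0), y; rewrite big_ord0 add0r.
have [Hk|] := pselect (forall x, K *m x = 0 ->
    (forall i, (i < k)%N -> dot (a i) x <= 0) -> dot g x <= 0).
  have [l [y [l0 gE]]] := IH a g Hk.
  exists (fun i => if i == k then 0 else l i), y; split.
    move=> i; rewrite ltnS leq_eqVlt; case: eqP => //= _ ik; exact: l0.
  rewrite big_ord_recr/= eqxx scale0r addr0 gE; congr (_ + _).
  by apply: eq_bigr => i _; rewrite ltn_eqF.
move=> /existsNP[x0 /not_implyP[Kx0 /not_implyP[ax0 /negP]]].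
rewrite -ltNge => gx0.
have akx0 : 0 < dot (a k) x0.
  rewrite ltNge; apply/negP => akx0; move: gx0; rewrite ltNge => /negP; apply.
  apply: H => // i; rewrite ltnS leq_eqVlt => /orP[/eqP->//|]; exact: ax0.
set t := dot (a k) x0 in akx0.
have [x Kx ax|l [y [l0 gE]]] := IH (fun i => a i - (dot (a i) x0 / t) *: a k)
    (g - (dot g x0 / t) *: a k).
  have := H (x - (dot (a k) x / t) *: x0).
  rewrite mulmxBr -scalemxAr Kx Kx0 scaler0 subrr => /(_ erefl).
  rewrite !dotBr !dotBl !dotZl !dotZr.
  have -> : dot g x - dot (a k) x / t * dot g x0 =
    dot g x - dot g x0 / t * dot (a k) x by ring.
  apply=> i; rewrite ltnS leq_eqVlt => /orP[/eqP->|ik].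
    by rewrite dotBr dotZr -/t divfK ?subrr// gt_eqF.
  have := ax i ik; rewrite !dotBr !dotBl !dotZl !dotZr.
  by rewrite [in X in X -> _]mulrAC [in X in _ -> X]mulrAC (mulrC (dot (a i)
    x0)).
exists (fun i => if i == k then dot g x0 / t -
  \sum_(j < k) l j * (dot (a j) x0 / t) else l i), y; split.
  move=> i; rewrite ltnS leq_eqVlt; case: eqP => /= [_ _|_]; last exact: l0.
  rewrite subr_ge0; apply: (@le_trans _ _ 0); last by rewrite divr_ge0// ltW.
  apply: sumr_le0 => j _; apply: mulr_ge0_le0; first exact: l0.
  by apply: mulr_le0_ge0; [exact: ax0|rewrite invr_ge0 ltW].
rewrite big_ord_recr/= eqxx -[LHS](subrK ((dot g x0 / t) *: a k)) gE.
under [in RHS]eq_bigr => i _ do rewrite ltn_eqF//.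
under [in LHS]eq_bigr => i _ do rewrite scalerBr scalerA.
rewrite sumrB -scaler_suml scalerBl -!addrA; congr (_ + _).
by rewrite [LHS]addrA [LHS]addrC.
Qed.

(** Farkas' lemma applied to the cone of feasible directions at p0, which is
    cut out by the constraints that are active at p0. *)
Lemma optimality_multipliers (p0 g : 'cV[R]_n) : orthant p0 ->
  (forall u, K *m u = K *m p0 -> orthant u -> dot g p0 <= dot g u) ->
  exists s y, [/\ orthant s, dot s p0 = 0 & g = s + K^T *m y].
Proof.
move=> p0_ge0 pmin.
pose a (i : nat) : 'cV[R]_n := \col_j - ((j == i :> nat) && (p0 j 0 == 0))%:R.
have dota (i : 'I_n) x : dot (a i) x = if p0 i 0 == 0 then - x i 0 else 0.
  rewrite dotE (bigD1 i)//= big1 ?addr0.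
    by rewrite mxE eqxx; case: eqP; rewrite /= (oppr0, mulN1r)// mul0r.
  by move=> j ji; rewrite mxE (negbTE (_ : j != i :> nat))//= oppr0 mul0r.
have [x Kx ax|l [y [l0 gE]]] := @farkas n a (- g).
  (* p0 + T^-1 x is feasible: T p0_j >= |x_j| wherever p0_j > 0 *)
  pose T := 1 + \sum_(j | p0 j 0 != 0) `|x j 0| / p0 j 0.
  have T0 : 0 < T.
    by rewrite ltr_wpDr// sumr_ge0// => j _; rewrite divr_ge0.
  rewrite dotNl oppr_le0.
  have /pmin : K *m (p0 + T^-1 *: x) = K *m p0.
    by rewrite mulmxDr -scalemxAr Kx scaler0 addr0.
  rewrite dotDr dotZr lerDl pmulr_rge0 ?invr_gt0//; apply=> i; rewrite !mxE.
  have := ax i (ltn_ord i); rewrite dota; case: eqP => [-> |/eqP pi _].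
    by rewrite oppr_le0 add0r => xi; rewrite mulr_ge0// invr_ge0 ltW.
  have pi0 : 0 < p0 i 0 by rewrite lt_neqAle eq_sym pi p0_ge0.
  have xT : `|x i 0| <= T * p0 i 0.
    rewrite -ler_pdivrMr// /T (bigD1 i)//= addrCA lerDl addr_ge0//.
    by rewrite sumr_ge0// => j _; rewrite divr_ge0.
  rewrite -(pmulr_rge0 _ T0) mulrDr mulVKf ?gt_eqF//.
  have := ler_norm (- x i 0); rewrite normrN; lra.
pose s : 'cV[R]_n := \col_j (if p0 j 0 == 0 then l j else 0).
exists s, (- y); split.
- by move=> i; rewrite mxE; case: eqP => // _; exact: l0.
- rewrite dotE big1// => i _; rewrite mxE; case: eqP => [->|];
    by rewrite (mulr0, mul0r).
rewrite mulmxN -[g]opprK gE opprD; congr (_ - _).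
apply/colP => j; rewrite !mxE summxE (bigD1 j)//= big1 ?addr0.
  by rewrite !mxE eqxx; case: eqP;
    rewrite /= (oppr0, mulrN1)// (mulr0, opprK)// oppr0.
by move=> i ij;
  rewrite !mxE (negbTE (_ : j != i :> nat)) 1?eq_sym//= oppr0 mulr0.
Qed.

End Farkas.

(** * Hoffman's error bound *)

Section Hoffman.
Context {R : realType} {n p : nat} (B : 'M[R]_(p, n)).

Lemma mulmx_bounded q (L : 'M[R]_(q, n)) :
  exists2 C, 0 <= C & forall u, enorm (L *m u) <= C * enorm u.
Proof.
have [->|/eqP L0] := eqVneq L 0.
  by exists 0 => // u; rewrite mul0mx enorm0 mul0r.
exists (lam_max L); last exact: lam_max_spec.
have [/ltW l0 _] := lam_min_spec L0.
exact: le_trans (lam_min_le_max L0).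
Qed.

Definition supported (I : {set 'I_n}) (u : 'cV[R]_n) :=
  forall i, i \notin I -> u i 0 = 0.

(** When no nonzero vector supported on I lies in the row space of B, the
    part supported on I of a vector of (R^I + Im B^T) is a linear function of
    it. *)
Lemma multipliers_bounded_indep (I : {set 'I_n}) :
  (forall u y, supported I u -> u = B^T *m y -> u = 0) ->
  exists2 C, 0 <= C & forall u y, supported I u ->
    enorm u <= C * enorm (u + B^T *m y).
Proof.
move=> indep.
pose D : 'M[R]_n := diag_mx (\row_i (i \in I)%:R).
have DE u : supported I u <-> (u^T <= D)%MS.
  split=> [uI|/submxP[w uE] i iI].
    apply/submxP; exists u^T; apply/rowP => i.
    rewrite mul_mx_diag !mxE; have [iI|/uI->] := boolP (i \in I).
      by rewrite mulr1.
    by rewrite mulr0.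
  rewrite -[u]trmxK uE mul_mx_diag !mxE (negbTE iI) mulr0//.
have DB0 : (D :&: <<B>>)%MS = 0.
  apply/row_matrixP => i; rewrite row0.
  have := row_sub i (D :&: <<B>>)%MS; rewrite sub_capmx genmxE.
  set r := row i _ => /andP[rD /submxP[w rE]].
  apply: trmx_inj; rewrite trmx0; apply: (@indep _ w^T).
    by apply/DE; rewrite trmxK.
  by rewrite -trmx_mul -rE.
have [C C0 CP] := mulmx_bounded (proj_mx D <<B>>%MS)^T.
exists C => // u y uI; apply: le_trans (CP _).
suff -> : (proj_mx D <<B>>%MS)^T *m (u + B^T *m y) = u by [].
apply: trmx_inj; rewrite trmx_mul trmxK linearD/= mulmxDl.
rewrite proj_mx_id ?proj_mx_0 ?addr0//; last by apply/DE.
by rewrite genmxE trmx_mul trmxK submxMl.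
Qed.

Definition bounded_multipliers (I : {set 'I_n}) (C : R) :=
  forall l y, orthant l -> supported I l -> exists l' y',
    [/\ orthant l', supported I l', l' + B^T *m y' = l + B^T *m y &
        enorm l' <= C * enorm (l + B^T *m y)].

(** Caratheodory's reduction: as long as the vectors indexed by I are
    linearly dependent modulo the row space of B, one of them can be dropped
    from a nonnegative combination. *)
Lemma bounded_multipliers_exist (I : {set 'I_n}) :
  exists2 C, 0 <= C & bounded_multipliers I C.
Proof.
have [k] := ubnP #|I|; elim: k I => // k IH I Ik.
have [indep|dep] := pselect
    (forall u y, supported I u -> u = B^T *m y -> u = 0).
  have [C C0 CP] := multipliers_bounded_indep indep.
  by exists C => // l y l0 lI; exists l, y; split=> //; exact: CP.
have [u [y0 [uI uE [i0 ui0]]]] : exists u y, [/\ supported I u, u = B^T *m y &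
    exists i, 0 < u i 0].
  apply: contrapT => H; apply: dep => u y uI uE; apply/colP => i; rewrite mxE.
  apply/eqP; rewrite eq_le !leNgt; apply/andP; split; apply/negP => ui.
    by apply: H; exists u, y; split=> //; exists i.
  apply: H; exists (- u), (- y); split.
  - by move=> j /uI; rewrite mxE => ->; rewrite oppr0.
  - by rewrite mulmxN -uE.
  - by exists i; rewrite mxE oppr_gt0.
have /choice[C CP] : forall i, exists c, 0 <= c /\
    (i \in I -> bounded_multipliers (I :\ i) c).
  move=> i; have [iI|iI] := boolP (i \in I); last by exists 0.
  have [|c c0 cP] := IH (I :\ i); last by exists c.
  by move: Ik; rewrite (cardsD1 i) iI.
exists (\sum_i C i); first by rewrite sumr_ge0// => i _; case: (CP i).
move=> l y l0 lI.
pose P := [pred i : 'I_n | 0 < u i 0].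
case: (@arg_minP _ _ _ i0 P (fun i => l i 0 / u i 0) ui0) => /= i ui imin.
have iI : i \in I.
  by apply: contraT => /uI ui00; move: ui; rewrite ui00 ltxx.
set t := l i 0 / u i 0 in imin.
have t0 : 0 <= t by rewrite divr_ge0// ?l0// ltW.
have lE : (l - t *: u) + B^T *m (y + t *: y0) = l + B^T *m y.
  by rewrite mulmxDr -scalemxAr -uE addrACA addNr addr0.
have [_ /(_ iI) bm] := CP i.
have [||l' [y' [l'0 l'I l'E l'C]]] := bm (l - t *: u) (y + t *: y0).
- move=> j; rewrite !mxE subr_ge0.
  have [uj|uj] := ltP 0 (u j 0); last first.
    by apply: le_trans (l0 j); rewrite mulr_ge0_le0.
  by rewrite -ler_pdivlMr//; exact: imin.
- move=> j; rewrite !inE negb_and negbK => /orP[/eqP->|jI].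
    by rewrite !mxE /t divfK ?subrr// gt_eqF.
  by rewrite !mxE lI// uI// mulr0 subr0.
exists l', y'; split=> //.
- by move=> j jI; apply: l'I; rewrite !inE negb_and jI orbT.
- by rewrite l'E.
move: l'C; rewrite lE => /le_trans; apply; rewrite ler_wpM2r ?enorm_ge0//.
by rewrite (bigD1 i)//= lerDl sumr_ge0// => j _; case: (CP j).
Qed.

(** First variation of the distance to v along the segment from w to u. *)
Lemma proj_obtuse (S : set 'cV[R]_n) v w u : is_proj S v w ->
  (forall t, 0 < t <= 1 -> S (w + t *: (u - w))) ->
  dot (v - w) (u - w) <= 0.
Proof.
move=> [Sw wmin] Su; rewrite leNgt; apply/negP => d0.
set d := dot _ _ in d0.
set N := dot (u - w) (u - w).
have N0 : 0 <= N by exact: dot_ge0.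
(* small enough for t * N < d, that is, for the move to get closer to v *)
pose t := d / (N + d + 1).
have T0 : 0 < N + d + 1 by lra.
have t0 : 0 < t by rewrite divr_gt0.
have t1 : t <= 1 by rewrite ler_pdivrMr//; lra.
have := wmin _ (Su t _); rewrite t0 t1 => /(_ isT).
rewrite -(ler_pXn2r (n := 2)) ?nnegrE ?enorm_ge0// !enorm_sqr.
rewrite opprD addrA dot_sqrB -/d -/N.
have tT : t * (N + d + 1) = d by rewrite divfK// gt_eqF.
have : t * N < d by rewrite -tT ltr_pM2l//; lra.
by rewrite -(ltr_pM2l t0); nra.
Qed.

Lemma orthant_segment (w u : 'cV[R]_n) t : orthant w -> orthant u ->
  0 < t <= 1 -> orthant (w + t *: (u - w)).
Proof.
move=> w0 u0 /andP[t0 t1] i; rewrite !mxE.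
have -> : w i 0 + t * (u i 0 - w i 0) = (1 - t) * w i 0 + t * u i 0 by ring.
by rewrite addr_ge0// mulr_ge0 ?subr_ge0// ?w0 ?u0// ltW.
Qed.

Lemma orthant0 : orthant (0 : 'cV[R]_n).
Proof. by move=> i; rewrite mxE. Qed.

(** Let p0 be the point of V `&` orthant nearest to x. The optimality
    conditions write p0 - x as l + B^T z with l >= 0 supported where p0
    vanishes, so that |p0 - x|^2 = l . (p0 - x) = - l . x is at most |l|
    times the distance of x to the orthant, while |l| <= C |p0 - x| for
    suitable multipliers. There are finitely many supports, so one constant C
    serves them all. *)
Lemma hoffman (d : 'cV[R]_p) : let V := [set x | B *m x = d] in
  (V `&` orthant) !=set0 ->
  exists2 C, 0 <= C &
    forall x, V x -> Dist x (V `&` orthant) <= C * Dist x orthant.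
Proof.
move=> V F0.
have /choice[C CP] : forall I : {set 'I_n}, exists c,
  0 <= c /\ bounded_multipliers I c.
  by move=> I; have [c c0 cP] := bounded_multipliers_exist I; exists c.
exists (\sum_I C I); first by rewrite sumr_ge0// => I _; case: (CP I).
move=> x Vx.
have cF : closed (V `&` orthant) by apply: closedI;
  [exact: closed_affine|exact: closed_orthant].
have [p0 pP] := nearest_point x cF F0.
have [w wP] := nearest_point x (@closed_orthant R n) (ex_intro _ 0 orthant0).
rewrite (Dist_proj pP) (Dist_proj wP).
have [[Vp p0_ge0] _] := pP.
have [|s [y [s0 sp gE]]] := @optimality_multipliers R n p B p0 (p0 - x) p0_ge0.
  move=> u; rewrite Vp => Vu u0.
  rewrite -subr_ge0 -dotBr -oppr_le0 -dotNl opprB.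
  apply: (proj_obtuse pP) => t t01; split; last exact: orthant_segment.
  by rewrite /V/= mulmxDr -scalemxAr mulmxBr Vp Vu subrr scaler0 addr0.
pose I := [set i | p0 i 0 == 0]%SET.
have sI : supported I s.
  move=> i; rewrite inE => pi; move: sp; rewrite dotE => /psumr_eq0P sp0.
  have /eqP := sp0 (fun i _ => mulr_ge0 (s0 i) (p0_ge0 i)) i isT.
  by rewrite mulf_eq0 (negbTE pi) orbF => /eqP.
have [_ bm] := CP I.
have [l [z [l0 lI lE lC]]] := bm s y s0 sI.
rewrite -gE in lE lC.
have lp : dot l p0 = 0.
  rewrite dotE big1// => i _; have [pi|pi] := eqVneq (p0 i 0) 0.
    by rewrite pi mulr0.
  by rewrite lI ?mul0r// inE.
have gg : enorm (p0 - x) ^+ 2 <= enorm l * enorm (x - w).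
  rewrite enorm_sqr -{1}lE dotDl (dotC (B^T *m z)) dot_mulmxr.
  rewrite mulmxBr Vp Vx subrr dot0r addr0 dotBr lp add0r enormB.
  apply: le_trans (dot_le_enorm _ _).
  rewrite dotBr -subr_ge0 opprK subrK dotE sumr_ge0// => i _.
  by rewrite mulr_ge0//; case: wP.
rewrite enormB.
have CI : C I <= \sum_I C I.
  by rewrite (bigD1 I)//= lerDl sumr_ge0// => J _; case: (CP J).
have [g0|/eqP gn] := eqVneq (p0 - x) 0.
  rewrite g0 enorm0 mulr_ge0 ?enorm_ge0//.
  by apply: le_trans CI; case: (CP I).
rewrite -(ler_pM2l (enorm_gt0 gn)) -expr2 (le_trans gg)//.
apply: (@le_trans _ _ (C I * enorm (p0 - x) * enorm (x - w))).
  by rewrite ler_wpM2r ?enorm_ge0.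
rewrite mulrA ler_wpM2r ?enorm_ge0// mulrC ler_wpM2l ?enorm_ge0//.
Qed.

End Hoffman.

(** * Error ratios, sharpness and the error bound for one problem *)

Section ErrorRatio.
Context {R : realType} {n : nat}.
Implicit Types V Opt : set 'cV[R]_n.

Lemma le_of_le_slack (D a k : R) : (forall e,
  0 < e -> D <= a + e * k) -> D <= a.
Proof.
move=> H; apply/ler_addgt0Pr => e e0.
have k1 : 0 < `|k| + 1 by rewrite ltr_wpDl.
have := H (e / (`|k| + 1)) (divr_gt0 e0 k1); move=> /le_trans; apply.
rewrite lerD2l mulrAC ler_pdivrMr// ler_pM2l//.
by have := ler_norm k; lra.
Qed.

Lemma Dist_closed_gt0 (C : set 'cV[R]_n) x : closed C -> C !=set0 -> ~ C x ->
  0 < Dist x C.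
Proof.
move=> cC C0 Cx; have [w wP] := nearest_point x cC C0.
rewrite (Dist_proj wP) enorm_gt0// => xw; apply: Cx.
by move/eqP: xw; rewrite subr_eq0 => /eqP->; case: wP.
Qed.

Section ThetaStar.
Variables (V Opt : set 'cV[R]_n) (C : R).
Hypothesis OptF : Opt `<=` V `&` orthant.
Hypothesis Opt0 : Opt !=set0.
Hypothesis hoffmanC : forall x,
  V x -> Dist x (V `&` orthant) <= C * Dist x orthant.

Let F0 : (V `&` orthant) !=set0.
Proof. by have [x /OptF] := Opt0; exists x. Qed.

Lemma Dist_theta x : V x -> Dist x (V `&` orthant) <= theta V x * Dist x
  orthant.
Proof.
move=> Vx; rewrite /theta; case: asboolP => [Fx|Fx].
  by rewrite Dist_mem0// mul1r Dist_ge0.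
rewrite divfK// gt_eqF//; apply: Dist_closed_gt0; first exact: closed_orthant.
  by have [y [_ y0]] := F0; exists y.
by move=> x0; apply: Fx.
Qed.

Lemma theta_le x : V x -> theta V x <= Num.max 1 C.
Proof.
move=> Vx; rewrite /theta le_max; case: asboolP => [Fx|Fx];
  first by rewrite lexx.
apply/orP; right; rewrite ler_pdivrMr; first exact: hoffmanC.
apply: Dist_closed_gt0; first exact: closed_orthant.
  by have [y [_ y0]] := F0; exists y.
by move=> x0; apply: Fx.
Qed.

Let T eps := [set theta V x | x in [set x | V x /\ Dist x Opt <= eps]].

Let T_ub eps : has_ubound (T eps).
Proof. by exists (Num.max 1 C) => _ [x [Vx _] <-]; exact: theta_le. Qed.

Let T_1 eps : 0 <= eps -> T eps 1.
Proof.
move=> e0; have [x Ox] := Opt0; exists x.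
  by split; [case: (OptF Ox)|rewrite Dist_mem0].
by rewrite /theta; case: asboolP => // H; case: (H (OptF Ox)).
Qed.

(** By Hoffman's bound the suprema that define theta_star are finite, so that
    they decrease to their limit as eps tends to 0. *)
Lemma theta_star_spec : 1 <= theta_star V Opt /\
  forall d, 0 < d -> exists2 eps, 0 < eps & forall x,
    V x -> Dist x Opt <= eps ->
    Dist x (V `&` orthant) <= (theta_star V Opt + d) * Dist x orthant.
Proof.
pose g eps := sup (T eps).
have g1 eps : 0 <= eps -> 1 <= g eps.
  by move=> e0; apply: ub_le_sup; [exact: T_ub|exact: T_1].
have lb : has_lbound (g @` `]0, 1[).
  by exists 1 => _ [e /= /[!in_itv]/= /andP[e0 _] <-]; rewrite g1// ltW.
have cvg_g : g e @[e --> 0^'+] --> inf (g @` `]0, 1[).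
  apply: (@nondecreasing_at_right_cvgr R g 0 (BLeft 1)) => //;
    first by rewrite bnd_simp.
  move=> e1 e2; rewrite !in_itv/= => /andP[e10 _] /andP[e20 _] e12.
  apply: le_sup; last by split; [exists 1; apply: T_1; exact: ltW|exact: T_ub].
    by move=> _ [x [Vx xe] <-]; exists (theta V x); split=> //; exists x => //;
      split => //; exact: le_trans e12.
  by exists 1; apply: T_1; exact: ltW.
have tE : theta_star V Opt = inf (g @` `]0, 1[) by exact: cvg_lim cvg_g.
have g0 : (g @` `]0, 1[) !=set0.
  by exists (g 2^-1); exists 2^-1 => //=; rewrite in_itv/=; lra.
split; first by rewrite tE;
  apply: lb_le_inf => // _ [e /= /[!in_itv]/= /andP[e0 _] <-]; rewrite g1// ltW.
move=> d d0; have [_ [e /= + <-] gt] := inf_adherent d0 (conj g0 lb).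
rewrite in_itv/= => /andP[e0 _]; exists e => // x Vx xe.
apply: le_trans (Dist_theta Vx) _; rewrite ler_wpM2r ?Dist_ge0//.
apply: le_trans (_ : g e <= _); last by rewrite tE ltW.
by apply: ub_le_sup; [exact: T_ub|exists x].
Qed.

End ThetaStar.
End ErrorRatio.

Section OneSidedErrorBound.
Context {R : realType} {n p : nat} (B : 'M[R]_(p, n)) (d : 'cV[R]_p)
  (g : 'cV[R]_n).
Let V : set 'cV[R]_n := [set x | B *m x = d].
Let F := V `&` orthant.
Let Opt : set 'cV[R]_n := [set x | F x /\ forall u, F u -> dot g x <= dot g u].
Let H : set 'cV[R]_n := [set x | exists2 xs, Opt xs & dot g x = dot g xs].
Hypothesis Bg : B *m g = 0.
Hypothesis Opt0 : Opt !=set0.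
Hypothesis FOpt : (F `\` Opt) !=set0.

Let OptF : Opt `<=` F. Proof. by move=> x []. Qed.

Let Opt_value x y : Opt x -> Opt y -> dot g x = dot g y.
Proof. by move=> [Fx xm] [Fy ym]; apply/eqP; rewrite eq_le xm// ym. Qed.

Let g_neq0 : g <> 0.
Proof.
move=> g0; have [x [Fx]] := FOpt; apply; split=> // u _.
by rewrite g0 !dot0l.
Qed.

Let gn0 : 0 < enorm g. Proof. exact: enorm_gt0. Qed.

Let VHE xs : Opt xs ->
  V `&` H = [set x | col_mx B g^T *m x = col_mx d (g^T *m xs)].
Proof.
move=> Oxs; apply/seteqP; split=> [x [Vx [ys Oys gx]]|x /=].
  rewrite /= mul_col_mx Vx; congr (col_mx _ _).
  apply/matrixP => i j; rewrite (ord1 i) (ord1 j).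
  by rewrite -/(dot g x) -/(dot g xs) gx; exact: Opt_value.
rewrite mul_col_mx => /eq_col_mx[Vx /matrixP/(_ 0 0) gx].
by split=> //; exists xs.
Qed.

Let OptE : Opt = (V `&` H) `&` orthant.
Proof.
apply/seteqP; split=> [x Ox|x [[Vx [xs [Fxs xsm] gx]] x0]].
  by have [Vx x0] := OptF Ox; split=> //; split=> //; exists x.
by split=> // u Fu; rewrite gx; exact: xsm.
Qed.

Lemma closed_opt : closed Opt.
Proof.
have [xs Oxs] := Opt0; rewrite OptE (VHE Oxs).
by apply: closedI; [exact: closed_affine|exact: closed_orthant].
Qed.

Let OptVH : Opt `<=` V `&` H. Proof. by rewrite OptE => x []. Qed.

(** As g is parallel to V, moving u along - g reaches the optimal level
    inside V. *)
Lemma Dist_level xs u : Opt xs -> F u ->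
  Dist u (V `&` H) <= (dot g u - dot g xs) / enorm g.
Proof.
move=> Oxs Fu.
have gg : dot g g != 0 by rewrite -enorm_sqr expf_neq0// gt_eqF.
pose k := (dot g u - dot g xs) / dot g g.
have k0 : 0 <= k.
  by rewrite divr_ge0 ?dot_ge0// subr_ge0; case: Oxs => _; exact.
have VHu : (V `&` H) (u - k *: g).
  have [Vu _] := Fu; split;
    first by rewrite /V/= mulmxBr -scalemxAr Bg scaler0 subr0.
  by exists xs => //; rewrite dotBr dotZr /k divfK// opprB addrC subrK.
apply: le_trans (Dist_le _ VHu) _.
rewrite opprB addrC subrK enormZ ger0_norm// /k -enorm_sqr.
rewrite le_eqVlt; apply/orP; left; apply/eqP; field.
by rewrite gt_eqF.
Qed.

Let mu := sharpness V H Opt.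

Let sharp_lb : has_lbound [set Dist x (V `&` H) / Dist x Opt | x in F `\` Opt].
Proof. by exists 0 => _ [x _ <-]; rewrite divr_ge0 ?Dist_ge0. Qed.

(** Hoffman's bound for V `&` H, whose intersection with the orthant is Opt. *)
Lemma sharpness_gt0 : 0 < mu.
Proof.
have [xs Oxs] := Opt0.
have VHO : ([set x | col_mx B g^T *m x = col_mx d (g^T *m xs)] `&` orthant) =
  Opt.
  by rewrite -VHE// -OptE.
have [|C C0] := @hoffman R n _ (col_mx B g^T) (col_mx d (g^T *m xs)).
  by rewrite VHO.
rewrite -(VHE Oxs) -OptE => CP.
apply: (@lt_le_trans _ _ (1 + C)^-1); first by rewrite invr_gt0; lra.
apply: lb_le_inf; first by have [x Hx] := FOpt;
  exists (Dist x (V `&` H) / Dist x Opt); exists x.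
move=> _ [x [[Vx x0] nOx] <-].
have Dp : 0 < Dist x Opt by apply: Dist_closed_gt0 => //; exact: closed_opt.
rewrite ler_pdivlMr// ler_pdivrMl; last by lra.
have [w wP] := @nearest_point R n (V `&` H) x
  (eq_ind_r closed (@closed_affine _ _ _ _ _) (VHE Oxs)) (ex_intro _ xs (OptVH
    Oxs)).
rewrite (Dist_proj wP).
apply: le_trans (Dist_triangle x w Opt0) _.
rewrite mulrDl mul1r lerD2l; case: (wP) => Vw _.
apply: le_trans (CP _ Vw) _; rewrite ler_wpM2l//.
by rewrite enormB; exact: Dist_le.
Qed.

Lemma sharpness_le1 : mu <= 1.
Proof.
have [x [Fx nOx]] := FOpt.
have Dp : 0 < Dist x Opt by apply: Dist_closed_gt0 => //; exact: closed_opt.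
apply: (@le_trans _ _ (Dist x (V `&` H) / Dist x Opt));
  first by apply: ge_inf => //; exists x.
rewrite ler_pdivrMr// mul1r; apply: le_Dist => // w /OptVH; exact: Dist_le.
Qed.

Lemma sharpness_bound x : F x -> mu * Dist x Opt <= Dist x (V `&` H).
Proof.
move=> Fx; have [Ox|nOx] := pselect (Opt x).
  by rewrite (Dist_mem0 Ox) mulr0 Dist_ge0.
have Dp : 0 < Dist x Opt by apply: Dist_closed_gt0 => //; exact: closed_opt.
by rewrite -ler_pdivlMr//; apply: ge_inf => //; exists x.
Qed.

Let th := theta_star V Opt.

Let F0 : F !=set0. Proof. by have [x [Fx _]] := FOpt; exists x. Qed.

Lemma theta_star_opt_spec : 1 <= th /\
  forall e, 0 < e -> exists2 eps, 0 < eps & forall x,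
    V x -> Dist x Opt <= eps ->
    Dist x F <= (th + e) * Dist x orthant.
Proof. by have [C _ CP] := hoffman F0; exact: theta_star_spec CP. Qed.

(** The error ratio is only controlled near Opt; contracting x towards its
    nearest optimal point xo scales all the quantities involved by the same
    factor t, so that the local bound yields a global one. The point xt of V
    is close to a feasible y, whose objective value cannot be below the
    optimum (hence 0 <= G) and whose distance to Opt is bounded by sharpness. *)
Lemma one_sided_error_bound x xs : V x -> Opt xs ->
  let G := dot g x - dot g xs + enorm g * th * Dist x orthant in
  0 <= G /\ Dist x Opt <= th * Dist x orthant + G / (enorm g * mu).
Proof.
move=> Vx Oxs0 G; rewrite /G {G}.
have [xo xoP] := nearest_point x closed_opt Opt0.
have [Oxo _] := xoP; rewrite (Opt_value Oxs0 Oxo) {xs Oxs0}.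
have [Vxo xo0] := OptF Oxo.
have [w wP] := nearest_point x (@closed_orthant R n) (ex_intro _ 0 (@orthant0 R
  n)).
have [w0 _] := wP.
set D := Dist x Opt; set dx := Dist x orthant.
have dxE : dx = enorm (x - w) := Dist_proj wP.
have DE : D = enorm (x - xo) := Dist_proj xoP.
have mu0 := sharpness_gt0.
have [th1 th_loc] := theta_star_opt_spec.
have key e : 0 < e -> let G := dot g x - dot g xo + enorm g * (th + e) * dx in
  0 <= G /\ D <= (th + e) * dx + G / (enorm g * mu).
  move=> e0 G; have [eps eps0 loc] := th_loc e e0.
  have D1 : 0 < D + 1 by rewrite ltr_wpDl// Dist_ge0.
  pose t := Num.min 1 (eps / (D + 1)).
  have t0 : 0 < t by rewrite lt_min ltr01 divr_gt0.
  have t1 : t <= 1 by rewrite ge_min lexx.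
  have tD : t * D <= eps.
    apply: (@le_trans _ _ (t * (D + 1))); first by rewrite ler_pM2l//; lra.
    by rewrite -ler_pdivlMr// ge_min lexx orbT.
  pose xt := xo + t *: (x - xo).
  have Vxt : V xt by rewrite /V/= mulmxDr -scalemxAr mulmxBr Vx Vxo subrr
    scaler0 addr0.
  have xtxo : enorm (xt - xo) = t * D.
    by rewrite /xt addrC addKr enormZ gtr0_norm// DE.
  have Dxt : Dist xt Opt <= t * D by rewrite -xtxo; exact: Dist_le.
  have tDx : t * D <= Dist xt Opt.
    have := Dist_triangle x xt Opt0; rewrite -/D.
    have -> : x - xt = (1 - t) *: (x - xo).
      by rewrite /xt opprD addrA scalerBl scale1r.
    rewrite enormZ ger0_norm ?subr_ge0// -DE; lra.
  have dxt : Dist xt orthant <= t * dx.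
    have wt : orthant (xo + t *: (w - xo)).
      by apply: orthant_segment => //; rewrite t0 t1.
    apply: le_trans (Dist_le _ wt) _.
    have -> : xt - (xo + t *: (w - xo)) = t *: (x - w).
      by rewrite /xt opprD addrACA subrr add0r -scalerBr opprB addrA subrK.
    by rewrite enormZ gtr0_norm// dxE.
  have cF : closed F by apply: closedI;
    [exact: closed_affine|exact: closed_orthant].
  have [y yP] := nearest_point xt cF F0.
  have [Fy _] := yP.
  have xty : enorm (xt - y) <= (th + e) * (t * dx).
    rewrite -(Dist_proj yP); apply: le_trans (loc _ Vxt (le_trans Dxt tD)) _.
    by rewrite ler_wpM2l//; lra.
  have gy : dot g y - dot g xo <= t * G.
    have -> : dot g y - dot g xo = dot g (y - xt) + t * (dot g x - dot g xo).
      by rewrite /xt dotBr dotDr dotZr dotBr; ring.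
    have := dot_le_enorm g (y - xt); rewrite enormB => gyx.
    have := ler_wpM2l (enorm_ge0 g) xty.
    rewrite /G; lra.
  have gy0 : 0 <= dot g y - dot g xo.
    by rewrite subr_ge0; case: Oxo => _; exact.
  split; first by rewrite -(pmulr_rge0 _ t0); exact: le_trans gy.
  have Dy : Dist y Opt <= t * G / (enorm g * mu).
    rewrite ler_pdivlMr ?mulr_gt0// mulrCA mulrC -ler_pdivlMr//.
    rewrite mulrC.
    apply: le_trans (sharpness_bound Fy) _;
      apply: le_trans (Dist_level Oxo Fy) _.
    by rewrite ler_wpM2r// invr_ge0 ltW.
  rewrite -(ler_pM2l t0); apply: le_trans tDx _.
  apply: le_trans (Dist_triangle xt y Opt0) _.
  have -> : t * ((th + e) * dx + G / (enorm g * mu)) =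
    (th + e) * (t * dx) + t * G / (enorm g * mu) by ring.
  exact: lerD.
split.
  apply: (@le_of_le_slack _ _ _ (enorm g * dx)) => e e0.
  by have [+ _] := key e e0; lra.
apply: (@le_of_le_slack _ _ _ (dx + dx / mu)) => e e0.
have [_ +] := key e e0; congr (_ <= _).
by field; rewrite !gt_eqF.
Qed.

End OneSidedErrorBound.

(** * Duality and the error bound for the primal-dual pair *)

Section LinearProgramGeometry.
Context {R : realType} {m n : nat}.
Variables (A : 'M[R]_(m, n)) (b : 'cV[R]_m) (c : 'cV[R]_n).
Hypothesis hLP : LP_assumption A b c.
Hypothesis hc : A *m c = 0.
Local Notation q := (qvec A b).
Local Notation K := ((cokermx A)^T).

Lemma mulmx_qvec : A *m q = b.
Proof.
have [[x [[Vx _] _]] _ _] := hLP.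
by rewrite /qvec !mulmxA -Vx mulmxA gram_pinvK.
Qed.

Lemma dot_qvec y : dot q (A^T *m y) = dot b y.
Proof. by rewrite dot_mulmxr mulmx_qvec dotC. Qed.

Lemma dot_row_space_c y : dot c (A^T *m y) = 0.
Proof. by rewrite dot_mulmxr hc dot0r. Qed.

Lemma dot_qvec_c : dot q c = 0.
Proof. by rewrite /qvec -mulmxA dotC dot_row_space_c. Qed.

Lemma coker_qvec : K *m q = 0.
Proof. by apply/row_space_null; exists (Defs.pinv (A *m A^T) *m b);
  rewrite /qvec mulmxA. Qed.

Lemma VdE : Vd A c = [set s | K *m s = K *m c].
Proof.
apply/seteqP; split=> [_ [y _ <-] /=|s /= Ks].
  rewrite mulmxDr (_ : K *m (A^T *m y) = 0) ?addr0//.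
  by apply/row_space_null; exists y.
have /row_space_null[y sE] : K *m (s - c) = 0 by rewrite mulmxBr Ks subrr.
by exists y => //; rewrite -sE addrC subrK.
Qed.

Lemma Vd_slack y : Vd A c (c - A^T *m y).
Proof. by exists (- y) => //; rewrite mulmxN. Qed.

Lemma SoptE : Sopt A b c =
  [set x | (([set s | K *m s = K *m c] `&` orthant) x) /\
           forall u, ([set s | K *m s = K *m c] `&` orthant) u ->
             dot q x <= dot q u].
Proof.
rewrite /Sopt /Fd VdE; apply/seteqP; split=> s [Fs H]; split=> // u Fu.
  by have := H u Fu; rewrite !dotBr lerD2l lerN2.
by have := H u Fu; rewrite !dotBr lerD2l lerN2.
Qed.

Lemma HdE : Hd A b c = [set s | exists2 ss, Sopt A b c ss & dot q s = dot q ss].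
Proof.
apply/seteqP; split=> s [ss Oss H]; exists ss => //.
  by move: H; rewrite !dotBr => /addrI/oppr_inj.
by rewrite !dotBr H.
Qed.

Lemma primal_dual_product x s : Vp A b x -> Vd A c s ->
  dot x s = dot c x + dot q s.
Proof.
move=> Vx [y _ <-]; rewrite !dotDr dot_qvec dot_qvec_c add0r.
by rewrite dot_mulmxr Vx (dotC x) (dotC y).
Qed.

(** The Lagrange multipliers of a primal optimum form a dual optimal slack,
    by complementarity. *)
Lemma dual_optimum : exists ss, Sopt A b c ss /\
  forall xs, Xopt A b c xs -> dot c xs + dot q ss = 0.
Proof.
have [[x0 Ox0] _ _] := hLP; have [[Vx0 x00] x0m] := Ox0.
have [|s [y [s0 sx cE]]] := @optimality_multipliers R n m A x0 c x00.
  by move=> u; rewrite Vx0 => Vu u0; exact: x0m.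
have Vs : Vd A c s.
  by exists (- y) => //; rewrite {1}cE mulmxN addrK.
have val : dot c x0 + dot q s = 0.
  by rewrite -primal_dual_product// dotC.
exists s; split.
  split=> // u [Vu u0]; rewrite !dotBr lerD2l lerN2.
  rewrite -(lerD2l (dot c x0)) val -primal_dual_product// dotE sumr_ge0// => i
    _.
  exact: mulr_ge0.
move=> xs [Fxs xsm]; rewrite -val; congr (_ + _).
by apply/eqP; rewrite eq_le xsm//= x0m.
Qed.

Lemma Sopt_nonempty : Sopt A b c !=set0.
Proof. by have [s [Os _]] := dual_optimum; exists s. Qed.

Lemma strong_duality xs ss : Xopt A b c xs -> Sopt A b c ss ->
  dot c xs + dot q ss = 0.
Proof.
move=> Oxs [Fss ssm]; have [s [[Fs sm] /(_ xs Oxs) <-]] := dual_optimum.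
congr (_ + _); apply/eqP; rewrite eq_le.
have := ssm s Fs; have := sm ss Fss.
by rewrite !dotBr !lerD2l !lerN2 => -> ->.
Qed.

Lemma Yopt_Sopt y : Yopt A b c y <-> Sopt A b c (c - A^T *m y).
Proof.
split=> [[y0 ym]|[[_ y0] ym]].
  split; first by split=> //; exact: Vd_slack.
  move=> _ [[v _ <-] v0].
  have := ym (- v); rewrite mulmxN opprK => /(_ v0).
  by rewrite -!dot_qvec mulmxN !dotBr !dotNr dotDr; lra.
split=> // v v0; have := ym (c - A^T *m v) (conj (Vd_slack v) v0).
by rewrite !subKr !dot_qvec.
Qed.

Lemma c_neq0 : c <> 0.
Proof.
move=> c0; have [_ [x [Fx nOx]] _] := hLP; apply: nOx; split=> // u _.
by rewrite c0 !dot0l.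
Qed.

Lemma qvec_neq0 : q <> 0.
Proof.
move=> q0; have [_ _ [s [Fs nOs]]] := hLP; apply: nOs; split=> // u _.
by rewrite q0 !dot0l.
Qed.

Lemma A_neq0 : A <> 0.
Proof. by move=> A0; apply: qvec_neq0; rewrite /qvec A0 trmx0 !mul0mx. Qed.

Lemma Dist_0_Vp : Dist 0 (Vp A b) = enorm q.
Proof.
rewrite -[RHS]enormN -[- q]add0r; apply: Dist_proj; split;
  first exact: mulmx_qvec.
move=> u Vu; rewrite !add0r !enormN.
have qn := enorm_gt0 qvec_neq0.
rewrite -(ler_pM2l qn) -expr2 enorm_sqr.
have -> : dot q q = dot q u; last exact: dot_le_enorm.
rewrite {1 3}/qvec -mulmxA (dotC _ q) (dotC _ u) !dot_mulmxr.
by rewrite mulmx_qvec Vu.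
Qed.

Lemma Dist_0_Vd : Dist 0 (Vd A c) = enorm c.
Proof.
rewrite -[RHS]enormN -[- c]add0r; apply: Dist_proj; split.
  by exists 0 => //; rewrite mulmx0 addr0.
move=> _ [y _ <-]; rewrite !add0r !enormN.
apply: enorm_le; rewrite !dotDl !dotDr (dotC (A^T *m y) c) dot_row_space_c.
by rewrite addr0 add0r lerDl dot_ge0.
Qed.

Let thp := theta_p_star A b c.
Let thd := theta_d_star A b c.
Let mup := mu_p A b c.
Let mud := mu_d A b c.

Lemma primal_constants : [/\ closed (Xopt A b c), 0 < mup, mup <= 1 & 1 <= thp].
Proof.
have [X0 FX _] := hLP; split.
- exact: closed_opt.
- exact: sharpness_gt0.
- exact: sharpness_le1.
- by case: (theta_star_opt_spec X0 FX).
Qed.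

Let dualOpt0 := eq_ind _ (fun S => S !=set0) Sopt_nonempty _ SoptE.

Let dualFO : (([set s | K *m s = K *m c] `&` orthant) `\`
  [set x | (([set s | K *m s = K *m c] `&` orthant) x) /\
           forall u, ([set s | K *m s = K *m c] `&` orthant) u ->
             dot q x <= dot q u]) !=set0.
Proof. by rewrite -SoptE -VdE; case: hLP. Qed.

Lemma dual_constants : [/\ closed (Sopt A b c), 0 < mud, mud <= 1 & 1 <= thd].
Proof.
rewrite /mud /mu_d /thd /theta_d_star HdE VdE SoptE; split.
- exact: closed_opt.
- exact: sharpness_gt0 dualOpt0 dualFO.
- exact: sharpness_le1 dualOpt0 dualFO.
- by case: (theta_star_opt_spec dualOpt0 dualFO).
Qed.

Lemma primal_error_bound x xs : Vp A b x -> Xopt A b c xs ->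
  let G := dot c x - dot c xs + enorm c * thp * Dist x orthant in
  0 <= G /\ Dist x (Xopt A b c) <= thp * Dist x orthant + G / (enorm c * mup).
Proof. by have [X0 FX _] := hLP; exact: one_sided_error_bound. Qed.

Lemma dual_error_bound s ss : Vd A c s -> Sopt A b c ss ->
  let G := dot q s - dot q ss + enorm q * thd * Dist s orthant in
  0 <= G /\ Dist s (Sopt A b c) <= thd * Dist s orthant + G / (enorm q * mud).
Proof.
rewrite /mud /mu_d /thd /theta_d_star HdE VdE SoptE => Vs Oss.
exact: (one_sided_error_bound coker_qvec dualOpt0 dualFO Vs Oss).
Qed.

(** The projection xh of x onto V_p has the same objective value as x, since
    xh - x is in the row space of A, and it is at distance at most dx from
    both x and the orthant. The slack of y is in V_d from the start. The two
    one-sided bounds apply to xh and s; their excess terms are nonnegative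
    and, the optimal values being opposite, add up to at most G, so that each
    one is at most G. *)
Lemma residual_error_bound x y : orthant x ->
  let s := c - A^T *m y in
  let dx := enorm (b - A *m x) / lam_min A in
  let ds := Dist s orthant in
  let G := dot c x - dot b y + enorm c * thp * dx + enorm q * thd * ds in
  [/\ 0 <= G,
      Dist x (Xopt A b c) <= dx + thp * dx + G / (enorm c * mup) &
      Dist s (Sopt A b c) <= thd * ds + G / (enorm q * mud)].
Proof.
move=> x0 s dx ds G.
have [l0 lP] := lam_min_spec A_neq0.
have [[xs Oxs] _ _] := hLP; have [ss Oss] := Sopt_nonempty.
have [_ mup0 _ thp1] := primal_constants.
have [_ mud0 _ thd1] := dual_constants.
have cn := enorm_gt0 c_neq0; have qn := enorm_gt0 qvec_neq0.
pose h := A^T *m (Defs.pinv (A *m A^T) *m (b - A *m x)).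
have Ah : A *m h = b - A *m x.
  rewrite /h -{1}mulmx_qvec -mulmxBr !mulmxA.
  by rewrite gram_pinvK mulmxBr mulmx_qvec.
pose xh := x + h.
have Vxh : Vp A b xh by rewrite /Vp/= mulmxDr Ah addrC subrK.
have hdx : enorm h <= dx.
  by rewrite ler_pdivlMr// mulrC -Ah; apply: lP; eexists.
have dxh : Dist xh orthant <= dx.
  by apply: le_trans (Dist_le _ x0) _; rewrite /xh addrC addKr.
have cxh : dot c xh = dot c x by rewrite dotDr dot_row_space_c addr0.
have [Gp0] := primal_error_bound Vxh Oxs; rewrite cxh.
set Gp := dot c x - _ + _ in Gp0 *.
have [Gd0] := dual_error_bound (Vd_slack y) Oss; rewrite -/s -/ds.
set Gd := dot q s - _ + _ in Gd0 *.
rewrite cxh -/Gp in Gp0.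
move=> Dd Dp.
have sd := strong_duality Oxs Oss.
have qs : dot q s = - dot b y by rewrite dotBr dot_qvec_c dot_qvec sub0r.
have cth : enorm c * thp * Dist xh orthant <= enorm c * thp * dx.
  by rewrite ler_wpM2l// mulr_ge0// ?enorm_ge0//; lra.
have GG : Gp + Gd <= G.
  have -> : Gp + Gd = dot c x + dot q s - (dot c xs + dot q ss)
     + enorm c * thp * Dist xh orthant + enorm q * thd * ds by rewrite /Gp /Gd;
       ring.
  by rewrite sd qs /G; lra.
have cm : 0 <= (enorm c * mup)^-1 by rewrite invr_ge0 mulr_ge0// ltW.
have qm : 0 <= (enorm q * mud)^-1 by rewrite invr_ge0 mulr_ge0// ltW.
split.
- by lra.
- apply: le_trans (Dist_triangle x xh (ex_intro _ xs Oxs)) _.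
  rewrite -addrA lerD//; first by rewrite enormB /xh addrC addKr.
  apply: le_trans Dp _; apply: lerD; first by rewrite ler_wpM2l//; lra.
  by rewrite ler_wpM2r//; lra.
- apply: le_trans Dd _; rewrite lerD2l.
  by rewrite ler_wpM2r//; lra.
Qed.

End LinearProgramGeometry.

(** * The primal-dual step and its averages *)

Section StepNorms.
Context {R : realType} {m n : nat}.
Variables (A : 'M[R]_(m, n)) (tau sigma : R).
Local Notation Z := ('cV[R]_n * 'cV[R]_m)%type.
Hypothesis tau0 : 0 < tau.
Hypothesis sigma0 : 0 < sigma.
Hypothesis A0 : A <> 0.
Hypothesis tau_sigma : 4%:R * (tau * sigma) * lam_max A ^+ 2 = 1.

(** e = -1 gives the form of normM, and e = 1 the one for which the step is a
    proximal-point step. *)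
Definition step_form (e : R) (z w : Z) : R :=
  tau^-1 * dot z.1 w.1 + sigma^-1 * dot z.2 w.2 +
  e * (dot z.2 (A *m w.1) + dot w.2 (A *m z.1)).

Definition step_norm e z := Num.sqrt (step_form e z z).

Lemma step_formDl e z z' w :
  step_form e (z + z') w = step_form e z w + step_form e z' w.
Proof. rewrite /step_form /= mulmxDr !dotDl !dotDr; ring. Qed.

Lemma step_formZl e a z w : step_form e (a *: z) w = a * step_form e z w.
Proof. rewrite /step_form /= -scalemxAr !dotZl !dotZr; ring. Qed.

Lemma step_formC e z w : step_form e z w = step_form e w z.
Proof. rewrite /step_form (dotC z.1) (dotC z.2 w.2); ring. Qed.

Let N (z : Z) := tau^-1 * dot z.1 z.1 + sigma^-1 * dot z.2 z.2.

Lemma cross_term_bound (x : 'cV[R]_n) (y : 'cV[R]_m) :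
  2%:R * `|dot y (A *m x)| <=
  (enorm x / Num.sqrt tau) * (enorm y / Num.sqrt sigma).
Proof.
set st := Num.sqrt tau; set ss := Num.sqrt sigma.
have st0 : 0 < st by rewrite sqrtr_gt0.
have ss0 : 0 < ss by rewrite sqrtr_gt0.
have [lm0 _] := lam_min_spec A0.
have lM0 : 0 < lam_max A := lt_le_trans lm0 (lam_min_le_max A0).
have half : 2%:R * (st * ss * lam_max A) = 1.
  have sq : (2%:R * (st * ss * lam_max A)) ^+ 2 = 1.
    by rewrite -[RHS]tau_sigma !exprMn sqr_sqrtr ?(ltW tau0)// sqr_sqrtr ?(ltW
      sigma0)//; ring.
  apply/eqP; rewrite -(eqrXn2 (n := 2)) ?ler01//;
    last by rewrite !mulr_ge0// ltW.
  by rewrite expr1n sq.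
have cs : `|dot y (A *m x)| <= enorm y * (lam_max A * enorm x).
  apply: (@le_trans _ _ (enorm y * enorm (A *m x))).
    rewrite ler_norml dot_le_enorm andbT lerNl -dotNl -(enormN y).
    exact: dot_le_enorm.
  by rewrite ler_wpM2l ?enorm_ge0// lam_max_spec.
have -> : enorm x / st * (enorm y / ss) =
  2%:R * (st * ss * lam_max A) * (enorm x / st * (enorm y / ss)).
  by rewrite half mul1r.
have -> : 2%:R * (st * ss * lam_max A) * (enorm x / st * (enorm y / ss)) =
  2%:R * (enorm y * (lam_max A * enorm x)).
  by field; rewrite !gt_eqF.
by rewrite ler_pM2l.
Qed.

Let NE z : N z = (enorm z.1 / Num.sqrt tau) ^+ 2 + (enorm z.2 / Num.sqrt sigma)
  ^+ 2.
Proof.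
rewrite /N !exprMn !exprVn !enorm_sqr (sqr_sqrtr (ltW tau0)) (sqr_sqrtr (ltW
  sigma0)).
by congr (_ + _); rewrite mulrC.
Qed.

(** The cross terms are at most half of the diagonal part, by the choice of
    the step-sizes. *)
Lemma step_form_bounds e z : e ^+ 2 = 1 ->
  N z <= 2%:R * step_form e z z <= 3%:R * N z.
Proof.
move=> e1; have := cross_term_bound z.1 z.2.
rewrite /step_form -/(N z) NE.
set X := _ / _; set Y := _ / _; set t := dot _ _ => H.
have et : `|e * t| = `|t|.
  suff -> : `|e * t| = `|e| * `|t| by rewrite -[`|e|]sqrtr_sqr e1 sqrtr1 mul1r.
  exact: normrM.
have H1 := ler_norm (e * t); have H2 := ler_norm (- (e * t)).
rewrite normrN in H2; rewrite et in H1 H2.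
have XY : 2%:R * (X * Y) <= X ^+ 2 + Y ^+ 2.
  by rewrite -subr_ge0; have := sqr_ge0 (X - Y); congr (_ <= _); ring.
have -> : e * (t + t) = 2%:R * (e * t) by ring.
by apply/andP; split; lra.
Qed.

Lemma step_form_ge0 e z : e ^+ 2 = 1 -> 0 <= step_form e z z.
Proof.
move=> e1; have /andP[+ _] := step_form_bounds z e1.
have : 0 <= N z by rewrite NE addr_ge0 ?sqr_ge0.
by lra.
Qed.

Lemma step_norm_ge0 e z : 0 <= step_norm e z.
Proof. exact: sqrtr_ge0. Qed.

Lemma step_norm_sqr e z : e ^+ 2 = 1 -> step_norm e z ^+ 2 = step_form e z z.
Proof. by move=> e1; rewrite sqr_sqrtr// step_form_ge0. Qed.

Lemma step_form_le e z w : e ^+ 2 = 1 ->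
  step_form e z w <= step_norm e z * step_norm e w.
Proof.
move=> e1; apply: form_CauchySchwarz => *; first exact: step_formDl.
- exact: step_formZl.
- exact: step_formC.
- exact: step_form_ge0.
Qed.

Lemma step_normD e z w : e ^+ 2 = 1 ->
  step_norm e (z + w) <= step_norm e z + step_norm e w.
Proof.
move=> e1; apply: form_triangle => *; first exact: step_formDl.
- exact: step_formZl.
- exact: step_formC.
- exact: step_form_ge0.
Qed.

Lemma step_normZ e a z : step_norm e (a *: z) = `|a| * step_norm e z.
Proof.
by apply: form_normZ => *; [exact: step_formZl|exact: step_formC].
Qed.

Lemma step_normN e z : step_norm e (- z) = step_norm e z.
Proof. by rewrite -scaleN1r step_normZ normrN1 mul1r. Qed.

Lemma step_normB e z w : step_norm e (z - w) = step_norm e (w - z).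
Proof. by rewrite -step_normN opprB. Qed.

(** 7/4 is a rational upper bound of sqrt 3. *)
Lemma step_norm_equiv e e' z : e ^+ 2 = 1 -> e' ^+ 2 = 1 ->
  step_norm e z <= 7%:R / 4%:R * step_norm e' z.
Proof.
move=> e1 e1'; apply: le_of_sqr_le; first by rewrite mulr_ge0 ?step_norm_ge0//;
  lra.
rewrite exprMn !step_norm_sqr//.
have /andP[_ H1] := step_form_bounds z e1.
have /andP[H2 _] := step_form_bounds z e1'.
by have := step_form_ge0 z e1'; lra.
Qed.

Lemma step_norm_le e z : e ^+ 2 = 1 ->
  step_norm e z <= enorm z.1 / Num.sqrt tau + enorm z.2 / Num.sqrt sigma.
Proof.
move=> e1; have st0 : 0 < Num.sqrt tau by rewrite sqrtr_gt0.
have ss0 : 0 < Num.sqrt sigma by rewrite sqrtr_gt0.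
apply: le_of_sqr_le; first by rewrite addr_ge0// divr_ge0 ?enorm_ge0 ?sqrtr_ge0.
rewrite step_norm_sqr//; have := cross_term_bound z.1 z.2.
rewrite /step_form -/(N z) NE.
set X := _ / _; set Y := _ / _; set t := dot _ _ => H.
have H1 := ler_norm (e * t).
have et : `|e * t| = `|t|.
  suff -> : `|e * t| = `|e| * `|t| by rewrite -[`|e|]sqrtr_sqr e1 sqrtr1 mul1r.
  exact: normrM.
rewrite et in H1.
have XY : 0 <= X * Y by apply: le_trans H; rewrite mulr_ge0.
have -> : e * (t + t) = 2%:R * (e * t) by ring.
have -> : (X + Y) ^+ 2 = X ^+ 2 + Y ^+ 2 + 2%:R * (X * Y) by ring.
by lra.
Qed.

Lemma step_norm_eq0 e z : e ^+ 2 = 1 -> step_norm e z = 0 -> z = 0.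
Proof.
move=> e1 z0; have /andP[+ _] := step_form_bounds z e1.
rewrite -step_norm_sqr// z0 expr0n mulr0 /N => H.
have d1 : 0 <= tau^-1 * dot z.1 z.1 by rewrite mulr_ge0 ?dot_ge0// invr_ge0 ltW.
have d2 : 0 <= sigma^-1 * dot z.2 z.2 by rewrite mulr_ge0 ?dot_ge0// invr_ge0
  ltW.
have /eqP : tau^-1 * dot z.1 z.1 = 0 by lra.
have /eqP : sigma^-1 * dot z.2 z.2 = 0 by lra.
rewrite !mulf_eq0 !invr_eq0 (gt_eqF tau0) (gt_eqF sigma0) /= => /eqP/dot_eq0 z2
  /eqP/dot_eq0 z1.
by rewrite [z]surjective_pairing z1 z2.
Qed.

Lemma normME z : normM A tau sigma z = step_norm (- 1) z.
Proof.
rewrite /normM /step_norm /Mmx; congr Num.sqrt.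
have dot_col_mx (u u' : 'cV[R]_n) (v v' : 'cV[R]_m) :
    dot (col_mx u v) (col_mx u' v') = dot u u' + dot v v'.
  by rewrite /dot tr_col_mx mul_row_col mxE.
rewrite mul_block_col !mul_scalar_mx !mulNmx dot_col_mx !dotDr !dotZr !dotNr.
rewrite dot_mulmxr /step_form; ring.
Qed.

End StepNorms.

Section PDHG.
Context {R : realType} {m n : nat}.
Variables (A : 'M[R]_(m, n)) (b : 'cV[R]_m) (c : 'cV[R]_n) (tau sigma : R).
Local Notation Z := ('cV[R]_n * 'cV[R]_m)%type.
Hypothesis tau0 : 0 < tau.
Hypothesis sigma0 : 0 < sigma.
Hypothesis A0 : A <> 0.
Hypothesis tau_sigma : 4%:R * (tau * sigma) * lam_max A ^+ 2 = 1.

Local Notation form := (step_form A tau sigma).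
Local Notation nrm := (step_norm A tau sigma).
Local Notation step := (PDHGstep A b c tau sigma).

Let one_sq : (1 : R) ^+ 2 = 1. Proof. exact: expr1n. Qed.
Let N1_sq : (- 1 : R) ^+ 2 = 1. Proof. by rewrite sqrrN expr1n. Qed.

Definition saddle_gap (z w : Z) : R := Lagr A b c z.1 w.2 - Lagr A b c w.1 z.2.

Lemma saddle_gapE z w : saddle_gap z w =
  dot c z.1 + dot b w.2 - dot w.2 (A *m z.1) - dot c w.1 - dot b z.2
  + dot z.2 (A *m w.1).
Proof. rewrite /saddle_gap /Lagr !dot_mulmxr; ring. Qed.

Lemma saddle_gap_scale z w t :
  saddle_gap z (z + t *: (w - z)) = t * saddle_gap z w.
Proof.
rewrite !saddle_gapE /= mulmxDr -scalemxAr mulmxBr.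
rewrite !(dotDr, dotDl, dotZr, dotZl, dotNr, dotNl); ring.
Qed.

Lemma step_proj z :
  is_proj orthant (z.1 - tau *: (c - A^T *m z.2)) (step z).1.
Proof.
rewrite /PDHGstep /=; set v := _ - _.
have [w wP] := nearest_point v (@closed_orthant R n) (ex_intro _ 0 (@orthant0 R
  n)).
exact: (@xgetPex _ v (is_proj orthant v) (ex_intro _ w wP)).
Qed.

Lemma step_ge0 z : orthant (step z).1.
Proof. by case: (step_proj z). Qed.

(** The update of y is explicit and that of x satisfies the variational
    inequality of a projection; together they say that z - step z, paired
    with step z - w through step_form 1, is at least the saddle gap. The
    claim follows by polarization. *)
Lemma step_descent z w : orthant w.1 ->
  2%:R * saddle_gap (step z) w <=
  form 1 (z - w) (z - w) - form 1 (step z - w) (step z - w).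
Proof.
move=> w0; have zP := step_proj z; have x'0 := step_ge0 z.
have y'E : (step z).2 = z.2 + sigma *: (b - A *m (2%:R *: (step z).1 - z.1)) by
  [].
move: zP x'0 y'E; case: (step z) => x' y' /= zP x'0 y'E.
have := @proj_obtuse R n _ _ _ w.1 zP (fun t => orthant_segment x'0 w0).
have dy u : dot u b - 2%:R * dot u (A *m x') + dot u (A *m z.1) =
    sigma^-1 * (dot u y' - dot u z.2).
  rewrite y'E dotDr dotZr dotBr mulmxBr dotBr -scalemxAr dotZr.
  by field; rewrite gt_eqF.
have y'2 := dy y'; have w2 := dy w.2.
rewrite saddle_gapE => /= obt.
have step0 := @step_form_ge0 _ _ _ A _ _ tau0 sigma0 A0 tau_sigma 1 (z - (x',
  y')) one_sq.
rewrite -subr_ge0; apply: le_trans step0 _.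
rewrite -subr_ge0.
have obt' : 0 <= 2%:R * tau^-1 *
   - dot (z.1 - tau *: (c - A^T *m z.2) - x') (w.1 - x').
  by rewrite mulr_ge0 ?oppr_ge0// mulr_ge0// invr_ge0 ltW.
apply: le_trans obt' _; rewrite le_eqVlt; apply/orP; left; apply/eqP.
rewrite /step_form /= !mulmxBr.
rewrite !(dotDl, dotDr, dotNl, dotNr, dotZl, dotZr).
rewrite (dotC (A^T *m z.2)) (dotC (A^T *m z.2)) !dot_mulmxr.
move: y'2 w2.
rewrite (dotC y' b) (dotC w.2 b) (dotC w.2 y') (dotC y' z.2) (dotC w.2 z.2).
rewrite (dotC x' z.1) (dotC w.1 x') (dotC w.1 z.1).
move=> y'2 w2.
have bw : dot b w.2 = 2%:R * dot w.2 (A *m x') - dot w.2 (A *m z.1)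
  + sigma^-1 * (dot y' w.2 - dot z.2 w.2) by rewrite -w2; ring.
have by' : dot b y' = 2%:R * dot y' (A *m x') - dot y' (A *m z.1)
  + sigma^-1 * (dot y' y' - dot z.2 y') by rewrite -y'2; ring.
rewrite bw by'; field; rewrite !gt_eqF//.
Qed.

Definition pdhg_sum k (z : Z) : Z := \sum_(i < k) iter i.+1 step z.
Definition pdhg_avg k z : Z := k%:R^-1 *: pdhg_sum k z.

Lemma pdhg_sumS k z : pdhg_sum k.+1 z = pdhg_sum k z + iter k.+1 step z.
Proof. by rewrite /pdhg_sum big_ord_recr. Qed.

Lemma pdhg_avg_ge0 k z : orthant (pdhg_avg k z).1.
Proof.
move=> i; rewrite mxE mulr_ge0// ?invr_ge0// ?ler0n//.
elim: k => [|k IH]; first by rewrite /pdhg_sum big_ord0 mxE.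
by rewrite pdhg_sumS mxE addr_ge0//; exact: step_ge0.
Qed.

(** The descent inequalities telescope, and saddle_gap is affine in its first
    argument. *)
Lemma pdhg_avg_gap k z w : (0 < k)%N -> orthant w.1 ->
  2%:R * k%:R * saddle_gap (pdhg_avg k z) w <=
  form 1 (z - w) (z - w) - form 1 (iter k step z - w) (iter k step z - w).
Proof.
move=> k0 w0.
pose Phi k (S : Z) := dot c S.1 + k%:R * dot b w.2 - dot w.2 (A *m S.1)
  - k%:R * dot c w.1 - dot b S.2 + dot S.2 (A *m w.1).
have PhiE : k%:R * saddle_gap (pdhg_avg k z) w = Phi k (pdhg_sum k z).
  rewrite saddle_gapE /pdhg_avg /Phi /= -scalemxAr !dotZr !dotZl.
  by field; rewrite pnatr_eq0 -lt0n.
rewrite -mulrA PhiE {PhiE k0}; elim: k => [|k IH].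
  rewrite /Phi /pdhg_sum big_ord0 /= mulmx0 !dot0r dot0l !mul0r subrr.
  by rewrite !(addr0, subr0) mulr0.
have := step_descent (iter k step z) w0; rewrite saddle_gapE pdhg_sumS /=.
set z' := step (iter k step z).
have -> : Phi k.+1 (pdhg_sum k z + z') = Phi k (pdhg_sum k z) +
  (dot c z'.1 + dot b w.2 - dot w.2 (A *m z'.1) - dot c w.1 - dot b z'.2
   + dot z'.2 (A *m w.1)).
  rewrite /Phi /= !mulmxDr !dotDr dotDl -natr1; ring.
by lra.
Qed.

Section Saddle.
Variable zs : Z.
Hypothesis zs0 : orthant zs.1.
Hypothesis zs_saddle : forall z, orthant z.1 -> 0 <= saddle_gap z zs.

Lemma pdhg_nonexpansive k z : nrm 1 (iter k step z - zs) <= nrm 1 (z - zs).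
Proof.
elim: k => //= k IH; apply: le_trans IH; apply: le_of_sqr_le.
  exact: step_norm_ge0.
rewrite !step_norm_sqr//.
have := step_descent (iter k step z) zs0.
by have := zs_saddle (step_ge0 (iter k step z)); lra.
Qed.

Lemma pdhg_avg_nonexpansive k z : (0 < k)%N ->
  nrm 1 (pdhg_avg k z - zs) <= nrm 1 (z - zs).
Proof.
move=> k0; have kR : 0 < (k%:R : R) by rewrite ltr0n.
have -> : pdhg_avg k z - zs = k%:R^-1 *: (pdhg_sum k z - k%:R *: zs).
  by rewrite /pdhg_avg scalerBr scalerA mulVf ?scale1r// gt_eqF.
rewrite step_normZ ger0_norm ?invr_ge0 ?ler0n// mulrC ler_pdivrMr//.
rewrite [leRHS]mulrC {k0 kR}; elim: k => [|k IH].
  rewrite /pdhg_sum big_ord0 scale0r subrr mul0r -(scale0r 0) step_normZ.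
  by rewrite normr0 mul0r.
rewrite pdhg_sumS -natr1 scalerDl scale1r opprD addrACA mulrDl mul1r.
apply: le_trans (step_normD _ _ _ _ _ _ _) _ => //.
by rewrite lerD// pdhg_nonexpansive.
Qed.

Section Ball.
Variables (k : nat) (z : Z).
Hypothesis k0 : (0 < k)%N.
Let zb := pdhg_avg k z.
Let r := normM A tau sigma (zb - z).
Let D := nrm 1 (z - zs).

(** With h = w - zb, a = zb - z and zk the last iterate, pdhg_avg_gap bounds
    2 k saddle_gap by 2 (h, zk - z) + |a|^2 in the form step_form 1. Here h
    and a have norm at most (7/4) r, while zk - z and a have norm at most 2
    D. *)
Lemma pdhg_ball_gap w : orthant w.1 -> normM A tau sigma (w - zb) <= r ->
  saddle_gap zb w <= r * (21%:R / 4%:R * D / k%:R).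
Proof.
rewrite /r !normME// => w0 wr.
have kR : 0 < (k%:R : R) by rewrite ltr0n.
have := pdhg_avg_gap z k0 w0; rewrite -/zb.
set zk := iter k step z.
pose a := zb - z; pose e := zb - zk; pose h := w - zb.
have -> : form 1 (z - w) (z - w) - form 1 (zk - w) (zk - w) =
    2%:R * form 1 h (zk - z) + form 1 a a - form 1 e e.
  have B1 := step_formDl A tau sigma 1;
    have BN z1 z2 : form 1 (- z1) z2 = - form 1 z1 z2.
    by rewrite -scaleN1r step_formZl mulN1r.
  have BC := step_formC A tau sigma 1.
  have BB u v u' v' : form 1 (u - v) (u' - v') =
      form 1 u u' - form 1 u v' - form 1 v u' + form 1 v v'.
    rewrite B1 BN (BC u) (BC v) !B1 !BN (BC u') (BC v') (BC u' v) (BC v' v);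
      ring.
  rewrite /h /a /e !BB.
  rewrite (BC w z) (BC w zk) (BC zk zb) (BC z zb); ring.
have h1 : form 1 h (zk - z) <= nrm 1 h * nrm 1 (zk - z) by exact: step_form_le.
have h2 : nrm 1 h <= 7%:R / 4%:R * nrm (- 1) h by exact: step_norm_equiv.
have a2 : nrm 1 a <= 7%:R / 4%:R * nrm (- 1) a by exact: step_norm_equiv.
have a1 : nrm 1 a <= 2%:R * D.
  rewrite /a -(subrKA zs); apply: le_trans (step_normD _ _ _ _ _ _ _) _ => //.
  rewrite (step_normB _ _ _ _ zs) -/D.
  by have := pdhg_avg_nonexpansive z k0; rewrite -/zb -/D; lra.
have z1 : nrm 1 (zk - z) <= 2%:R * D.
  rewrite -(subrKA zs); apply: le_trans (step_normD _ _ _ _ _ _ _) _ => //.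
  rewrite (step_normB _ _ _ _ zs) -/D.
  by have := pdhg_nonexpansive k z; rewrite -/zk -/D; lra.
have e0 : 0 <= form 1 e e by exact: step_form_ge0.
rewrite -(step_norm_sqr tau0 sigma0 A0 tau_sigma a)//.
have D0 : 0 <= D := step_norm_ge0 _ _ _ _ _.
set ra := nrm (- 1) a in a2 wr *.
rewrite -/h in wr.
have h3 : nrm 1 h <= 7%:R / 4%:R * ra by apply: le_trans h2 _;
  rewrite ler_pM2l//; lra.
have h4 : nrm 1 h * nrm 1 (zk - z) <= 7%:R / 4%:R * ra * (2%:R * D).
  by apply: ler_pM => //; exact: step_norm_ge0.
have a4 : nrm 1 a ^+ 2 <= 7%:R / 4%:R * ra * (2%:R * D).
  by rewrite expr2; apply: ler_pM => //; exact: step_norm_ge0.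
move=> H; rewrite -(ler_pM2l kR).
have -> : k%:R * (ra * (21%:R / 4%:R * D / k%:R)) = 21%:R / 4%:R * (ra * D).
  by field; rewrite gt_eqF.
have : 2%:R * (k%:R * saddle_gap zb w) <= 2%:R * (7%:R / 4%:R * ra * (2%:R *
  D)) + 7%:R / 4%:R * ra * (2%:R * D).
  by rewrite mulrA; apply: le_trans H _; lra.
have -> : 7%:R / 4%:R * ra * (2%:R * D) = 7%:R / 2%:R * (ra * D) by field.
by set x := ra * D; lra.
Qed.

Let ball_ne : [set saddle_gap zb w | w in [set w : Z | orthant w.1 /\ normM A
  tau sigma (w - zb) <= r]] !=set0.
Proof.
exists (saddle_gap zb zb); exists zb => //; split; first exact: pdhg_avg_ge0.
rewrite subrr normME// -(scale0r 0) step_normZ normr0 mul0r.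
by rewrite /r normME// step_norm_ge0.
Qed.

Lemma pdhg_gap_le : gap A b c tau sigma r zb <= 21%:R / 4%:R * D / k%:R.
Proof.
have r0 : 0 <= r by rewrite /r normME// step_norm_ge0.
have B0 : 0 <= 21%:R / 4%:R * D / k%:R.
  rewrite mulr_ge0 ?invr_ge0 ?ler0n// mulr_ge0 ?step_norm_ge0//; lra.
rewrite /gap; have [r00|rn0] := eqVneq r 0; first by rewrite r00 invr0 mul0r.
have rp : 0 < r by rewrite lt_neqAle eq_sym rn0.
rewrite mulrC ler_pdivrMr// mulrC; apply: ge_sup => // _ [w [w0 wr] <-].
exact: pdhg_ball_gap.
Qed.

Lemma saddle_gap_le_gap w : orthant w.1 -> normM A tau sigma (w - zb) <= r ->
  saddle_gap zb w <= r * gap A b c tau sigma r zb.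
Proof.
move=> w0 wr; have := pdhg_ball_gap w0 wr.
have r0 : 0 <= r by rewrite /r normME// step_norm_ge0.
rewrite /gap; have [->|rn0] := eqVneq r 0; first by rewrite !mul0r.
move=> _; rewrite mulVKf//; apply: ub_le_sup; last by exists w => //; split.
by exists (r * (21%:R / 4%:R * D / k%:R)) => _ [v [v0 vr] <-];
  exact: pdhg_ball_gap.
Qed.

Lemma gap_ge0 : 0 <= gap A b c tau sigma r zb.
Proof.
have r0 : 0 <= r by rewrite /r normME// step_norm_ge0.
have := @saddle_gap_le_gap zb (pdhg_avg_ge0 _ _).
rewrite subrr {1}normME// -{1}(scale0r 0) step_normZ normr0 mul0r => /(_ r0).
rewrite /saddle_gap subrr.
have [r00|rn0] := eqVneq r 0; first by rewrite /gap r00 invr0 !mul0r.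
by rewrite pmulr_rge0// lt_neqAle eq_sym rn0.
Qed.

(** If the average over an inner loop returns to the starting point, then this
    point is a saddle point: the bound on the saddle gap is quadratic in the
    distance of w whereas the gap itself is affine. *)
Lemma pdhg_avg_fixed w : zb = z -> orthant w.1 -> saddle_gap zb w <= 0.
Proof.
move=> zbz w0; have kR : 0 < (k%:R : R) by rewrite ltr0n.
have zb0 : orthant zb.1 := pdhg_avg_ge0 _ _.
pose f := form 1 (zb - w) (zb - w).
have f0 : 0 <= f by exact: step_form_ge0.
have key t : 0 < t <= 1 -> 2%:R * k%:R * saddle_gap zb w <= t * f.
  move=> /andP[t0 t1]; pose wt := zb + t *: (w - zb).
  have wt0 : orthant wt.1 by apply: orthant_segment => //; rewrite t0 t1.
  have := pdhg_avg_gap z k0 wt0; rewrite -/zb -zbz.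
  rewrite saddle_gap_scale.
  have -> : zb - wt = t *: (zb - w).
    by rewrite /wt opprD addrA subrr sub0r -scalerN opprB.
  rewrite step_formZl step_formC step_formZl -/f.
  have := @step_form_ge0 _ _ _ A _ _ tau0 sigma0 A0 tau_sigma 1 (iter k step zb
    - wt) one_sq.
  move=> e0 H; rewrite -(ler_pM2l t0).
  have -> : t * (2%:R * k%:R * saddle_gap zb w) = 2%:R * k%:R * (t * saddle_gap
    zb w) by ring.
  by apply: le_trans H _; rewrite lerBlDr lerDl.
rewrite leNgt; apply/negP => g0.
have G0 : 0 < 2%:R * k%:R * saddle_gap zb w by rewrite !mulr_gt0.
set G := 2%:R * k%:R * _ in key G0.
pose t := Num.min 1 (G / (2%:R * (f + 1))).
have f1 : 0 < 2%:R * (f + 1) by lra.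
have t0 : 0 < t by rewrite lt_min ltr01 divr_gt0.
have t1 : t <= 1 by rewrite ge_min lexx.
have := key t; rewrite t0 t1 => /(_ isT).
have tG : t * (2%:R * (f + 1)) <= G by rewrite -ler_pdivlMr// ge_min lexx orbT.
by nra.
Qed.

End Ball.
End Saddle.
End PDHG.

(** * From the normalized duality gap to the distance to optima *)

(** As P and Q are the inverses of the sharpness constants, they are at least
    1; this allows the terms without P and Q to be absorbed in the others. *)
Lemma error_arith (R : realType) (rho thp thd Dt H P Q : R) :
  0 <= rho -> 1 <= thp -> 1 <= thd -> 0 <= Dt -> 1 <= P -> 1 <= Q ->
  H <= rho * (7%:R / 2%:R * Dt + thp + thd) ->
  rho * (1 + thp) + H * P + (rho * thd + H * Q) <=
  7%:R / 2%:R * ((P + Q) * (rho * (thp + thd + Dt))).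
Proof.
move=> rho0 thp1 thd1 Dt0 P1 Q1; rewrite -addrA; set th := thp + thd => HH.
have th2 : 2%:R <= th by rewrite /th; lra.
have S2 : 2%:R <= P + Q by lra.
have -> : rho * (1 + thp) + H * P + (rho * thd + H * Q) =
  rho * (1 + th) + H * (P + Q) by rewrite /th; ring.
clearbody th; set S := P + Q in S2 *; clearbody S; clear thp1 thd1 P1 Q1.
have HS : H * S <= rho * (7%:R / 2%:R * Dt + th) * S.
  by rewrite ler_wpM2r//; lra.
have X1 : rho * (1 + th) <= rho * (3%:R / 2%:R * th) by rewrite ler_wpM2l//;
  lra.
have X2 : 2%:R * (rho * th) <= S * (rho * th).
  by rewrite ler_wpM2r// mulr_ge0//; lra.
have X3 : 0 <= S * (rho * th) by rewrite !mulr_ge0//; lra.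
have X4 : 0 <= S * (rho * Dt) by rewrite !mulr_ge0//; lra.
by lra.
Qed.

Section ErrorByGap.
Context {R : realType} {m n : nat}.
Variables (A : 'M[R]_(m, n)) (b : 'cV[R]_m) (c : 'cV[R]_n) (tau sigma : R).
Local Notation Z := ('cV[R]_n * 'cV[R]_m)%type.
Local Notation q := (qvec A b).
Hypothesis hLP : LP_assumption A b c.
Hypothesis hc : A *m c = 0.
Hypothesis htau : tau = enorm q / (2%:R * kappa A * enorm c).
Hypothesis hsigma :
  sigma = enorm c / (2%:R * enorm q * lam_max A * lam_min A).

Let cn : 0 < enorm c := enorm_gt0 (c_neq0 hLP).
Let qn : 0 < enorm q := enorm_gt0 (qvec_neq0 hLP).
Let A0 : A <> 0 := A_neq0 hLP.
Let lm0 : 0 < lam_min A := (lam_min_spec A0).1.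
Let lM0 : 0 < lam_max A := lt_le_trans lm0 (lam_min_le_max A0).

Lemma kappa_ge1 : 1 <= kappa A.
Proof. by rewrite /kappa ler_pdivlMr// mul1r lam_min_le_max. Qed.

Let k0 : 0 < kappa A. Proof. exact: lt_le_trans kappa_ge1. Qed.

Lemma tau_gt0 : 0 < tau.
Proof. by rewrite htau; apply: divr_gt0 => //; do 2!apply: mulr_gt0 => //. Qed.

Lemma sigma_gt0 : 0 < sigma.
Proof. by rewrite hsigma; apply: divr_gt0 => //;
  do 3!apply: mulr_gt0 => //. Qed.

Lemma tau_sigma_lam_max : 4%:R * (tau * sigma) * lam_max A ^+ 2 = 1.
Proof. by rewrite htau hsigma /kappa; field; rewrite !gt_eqF. Qed.

Local Notation st := (Num.sqrt tau).
Local Notation ss := (Num.sqrt sigma).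
(** A primal error d contributes primal_weight * d to the step norm; a dual
    slack error d comes from an error at most d / lam_min A in y, which
    contributes dual_weight * d. *)
Definition primal_weight := st^-1.
Definition dual_weight := (ss * lam_min A)^-1.
Local Notation v := primal_weight.
Local Notation u := dual_weight.

Let st0 : 0 < st. Proof. by rewrite sqrtr_gt0 tau_gt0. Qed.
Let ss0 : 0 < ss. Proof. by rewrite sqrtr_gt0 sigma_gt0. Qed.

Lemma primal_weight_gt0 : 0 < v. Proof. by rewrite invr_gt0. Qed.
Lemma dual_weight_gt0 : 0 < u. Proof. by rewrite invr_gt0 mulr_gt0. Qed.

Let st_sq : st ^+ 2 = tau. Proof. by rewrite sqr_sqrtr// ltW// tau_gt0. Qed.
Let ss_sq : ss ^+ 2 = sigma. Proof. by rewrite sqr_sqrtr// ltW// sigma_gt0. Qed.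

Lemma weightM : u * v = 2%:R * kappa A.
Proof.
apply/eqP; rewrite -(eqrXn2 (n := 2))//; last 2 first.
- by rewrite mulr_ge0// ltW// ?primal_weight_gt0 ?dual_weight_gt0.
- by rewrite mulr_ge0// ltW.
apply/eqP; rewrite exprMn !exprVn exprMn st_sq ss_sq htau hsigma /kappa.
by field; rewrite !gt_eqF.
Qed.

Lemma weight_balance : enorm c * u = enorm q * v.
Proof.
apply/eqP; rewrite -(eqrXn2 (n := 2))//; last 2 first.
- by rewrite mulr_ge0// ltW// dual_weight_gt0.
- by rewrite mulr_ge0// ltW// primal_weight_gt0.
apply/eqP; rewrite !exprMn !exprVn exprMn st_sq ss_sq htau hsigma /kappa.
by field; rewrite !gt_eqF.
Qed.

Local Notation sgap := (saddle_gap A b c).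

Lemma saddle_gap_shift_dual (z : Z) d :
  sgap z (z.1, z.2 + d) = dot d (b - A *m z.1).
Proof.
by rewrite saddle_gapE /= dotDr dotDl dotBr (dotC d b); ring.
Qed.

Lemma saddle_gap_shift_primal (z : Z) d :
  sgap z (z.1 + d, z.2) = - dot d (c - A^T *m z.2).
Proof.
by rewrite saddle_gapE /= mulmxDr !dotDr dotNr dot_mulmxr (dotC d c); ring.
Qed.

Lemma saddle_gap_0 (z : Z) : sgap z 0 = dot c z.1 - dot b z.2.
Proof.
by rewrite saddle_gapE /= mulmx0 !dot0r dot0l; ring.
Qed.

(** s + d is the projection of s onto the orthant. *)
Lemma negative_part (s : 'cV[R]_n) : exists d, [/\ orthant d, orthant (s + d),
  dot d s = - dot d d & Dist s orthant = enorm d].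
Proof.
have [w wP] := nearest_point s (@closed_orthant R n) (ex_intro _ 0 (@orthant0 R
  n)).
have [w0 _] := wP.
have obt u' : orthant u' -> dot (s - w) (u' - w) <= 0.
  by move=> u0; apply: (proj_obtuse wP) => t; exact: orthant_segment.
have sw : dot (s - w) w = 0.
  apply/eqP; rewrite eq_le; apply/andP; split.
    have : orthant (2%:R *: w) by move=> i; rewrite mxE mulr_ge0// w0.
    by move/obt; rewrite scaler_nat mulr2n addrK.
  by have := obt 0 (@orthant0 R n); rewrite sub0r dotNr oppr_le0.
exists (w - s); split.
- move=> i; have : orthant (w + delta_mx i 0).
    by move=> j; rewrite !mxE addr_ge0// ?w0//= ler0n.
  move/obt; rewrite (addrC w) addrK dotE (bigD1 i)//= big1 ?addr0.
    by rewrite [delta_mx _ _ _ _]mxE !eqxx mulr1 !mxE; lra.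
  by move=> j ji; rewrite [delta_mx _ _ _ _]mxE (negbTE ji) mulr0.
- by rewrite addrC subrK.
- have -> : dot (w - s) s = dot (w - s) w - dot (w - s) (w - s).
    by rewrite -dotBr subKr.
  by rewrite -(opprB s w) dotNl sw oppr0 sub0r.
- by rewrite enormB; exact: Dist_proj.
Qed.

Lemma Zopt_saddle (zs : Z) : Zopt A b c zs ->
  forall z, orthant z.1 -> 0 <= sgap z zs.
Proof.
move=> [Oxs Oys] z z0.
have sd := strong_duality hLP hc Oxs ((Yopt_Sopt hLP zs.2).1 Oys).
have [[Vxs _] _] := Oxs; have [ys0 _] := Oys.
rewrite dotBr (dot_qvec_c b hc) (dot_qvec hLP) sub0r in sd.
have -> : sgap z zs = dot z.1 (c - A^T *m zs.2) - (dot c zs.1 - dot b zs.2).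
  rewrite saddle_gapE Vxs dotBr dot_mulmxr (dotC z.1 c) (dotC z.2 b); ring.
by rewrite sd subr0 dotE sumr_ge0// => i _; rewrite mulr_ge0.
Qed.

(** The dual shift by b - A x, the primal shift by the negative part of the
    slack, and w = 0 show in turn that x is feasible, that y is feasible, and
    that their objective values agree. *)
Lemma saddle_Zopt (z : Z) : orthant z.1 ->
  (forall w, orthant w.1 -> sgap z w <= 0) -> Zopt A b c z.
Proof.
move=> z0 H.
have Vz : A *m z.1 = b.
  have := H (z.1, z.2 + (b - A *m z.1)) z0.
  rewrite saddle_gap_shift_dual => d0.
  have /dot_eq0/eqP : dot (b - A *m z.1) (b - A *m z.1) = 0.
    by apply/eqP; rewrite eq_le d0 dot_ge0.
  by rewrite subr_eq0 => /eqP.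
set s := c - A^T *m z.2.
have s0 : orthant s.
  have [d [d0 sd ds _]] := negative_part s.
  have := H (z.1 + d, z.2); rewrite saddle_gap_shift_primal -/s ds opprK => dd.
  have : dot d d = 0.
    apply/eqP; rewrite eq_le dot_ge0 andbT; apply: dd => i.
    by rewrite mxE addr_ge0.
  by move/dot_eq0 => dE; move: sd; rewrite dE addr0.
have := H 0 (@orthant0 R n); rewrite saddle_gap_0 => cb.
have weak x y : orthant x -> A *m x = b -> orthant (c - A^T *m y) ->
    dot b y <= dot c x.
  move=> x0 Vx y0; rewrite -subr_ge0.
  have -> : dot c x - dot b y = dot x (c - A^T *m y).
    by rewrite dotBr dot_mulmxr Vx (dotC x) (dotC y).
  by rewrite dotE sumr_ge0// => i _; rewrite mulr_ge0.
split; split=> //.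
- by move=> x [Vx x0]; have := weak x z.2 x0 Vx s0; lra.
- by move=> y y0; have := weak z.1 y z0 Vz y0; lra.
Qed.

Definition weighted_error (z : Z) : R :=
  v * Dist z.1 (Xopt A b c) + u * Dist (c - A^T *m z.2) (Sopt A b c).

(** The optimal slack nearest to that of z is the slack of a y that differs
    from z.2 by an element of the range of A, on which A^T expands by lam_min
    A at least. *)
Lemma Zopt_near (z : Z) : exists2 zs, Zopt A b c zs &
  step_norm A tau sigma 1 (z - zs) <= weighted_error z.
Proof.
have [cX _ _ _] := primal_constants hLP;
  have [cS _ _ _] := dual_constants hLP hc.
have [X0 _ _] := hLP.
have [xs xP] := nearest_point z.1 cX X0.
have [sl sP] := nearest_point (c - A^T *m z.2) cS (Sopt_nonempty hLP hc).
have [Oxs _] := xP; have [Osl _] := sP.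
have [[[y' _ slE] _] _] := Osl.
pose P := A *m A^T *m Defs.pinv (A *m A^T).
have AP : A^T *m P = A^T.
  have [_ _ sym _] := pinvP (A *m A^T).
  by rewrite /P -sym -trmx_mul gram_pinvK.
pose d := P *m (z.2 + y').
have Ad : A^T *m d = A^T *m z.2 + A^T *m y' by rewrite mulmxA AP mulmxDr.
have ysE : c - A^T *m (z.2 - d) = sl.
  by rewrite mulmxBr Ad -slE opprB (addrAC (A^T *m z.2)) subrr add0r.
exists (xs, z.2 - d).
  by split=> //; apply/(Yopt_Sopt hLP); rewrite /= ysE.
apply: le_trans (step_norm_le tau_gt0 sigma_gt0 A0 tau_sigma_lam_max _ _) _.
  exact: expr1n.
rewrite /= /weighted_error (Dist_proj xP) (Dist_proj sP) mulrC lerD2l.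
rewrite opprB addrC subrK.
have -> : c - A^T *m z.2 - sl = - (A^T *m d).
  by rewrite Ad -slE opprD addrACA subrr add0r opprD.
have dn : lam_min A * enorm d <= enorm (A^T *m d).
  by apply: lam_min_tr => //; eexists; rewrite /d /P -!mulmxA.
have -> : enorm d / ss = u * (lam_min A * enorm d).
  by rewrite /dual_weight; field; rewrite !gt_eqF.
by rewrite enormN ler_wpM2l// ltW// dual_weight_gt0.
Qed.

Section Residuals.
Variables (z : Z) (r rho : R).
Hypothesis z0 : orthant z.1.
Hypothesis r0 : 0 < r.
Hypothesis gap_rho : forall w, orthant w.1 ->
  normM A tau sigma (w - z) <= r -> sgap z w <= r * rho.

Let NM := normME A tau sigma.

Let norm_primal (d : 'cV[R]_n) : normM A tau sigma (d, 0) <= enorm d / st.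
Proof.
rewrite NM; apply: le_trans (step_norm_le tau_gt0 sigma_gt0 A0
  tau_sigma_lam_max _ _) _.
  by rewrite sqrrN expr1n.
by rewrite /= enorm0 mul0r addr0.
Qed.

Let norm_dual (d : 'cV[R]_m) : normM A tau sigma (0, d) <= enorm d / ss.
Proof.
rewrite NM; apply: le_trans (step_norm_le tau_gt0 sigma_gt0 A0
  tau_sigma_lam_max _ _) _.
  by rewrite sqrrN expr1n.
by rewrite /= enorm0 mul0r add0r.
Qed.

Lemma gap_bound_ge0 : 0 <= rho.
Proof.
have := gap_rho z0;
  rewrite subrr NM -{1}(scale0r (0 : Z)) step_normZ normr0 mul0r.
by move=> /(_ (ltW r0)); rewrite /saddle_gap subrr pmulr_rge0.
Qed.

Lemma primal_residual_le : enorm (b - A *m z.1) <= rho / ss.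
Proof.
set h := b - A *m z.1; have [->|/eqP hn] := eqVneq h 0.
  by rewrite enorm0 divr_ge0 ?gap_bound_ge0// ltW.
have hp := enorm_gt0 hn.
pose d := (r * ss / enorm h) *: h.
have := @gap_rho (z.1, z.2 + d) z0.
rewrite saddle_gap_shift_dual -/h.
have -> : (z.1, z.2 + d) - z = (0, d).
  by rewrite [z in X in _ - X]surjective_pairing; congr (_, _);
    rewrite ?subrr// addrC addKr.
have -> : dot d h = r * (ss * enorm h).
  by rewrite dotZl -enorm_sqr; field; rewrite gt_eqF.
rewrite ler_pM2l// ler_pdivlMr// (mulrC ss); apply.
apply: le_trans (norm_dual _) _; rewrite enormZ ger0_norm.
  by rewrite le_eqVlt; apply/orP; left; apply/eqP; field; rewrite !gt_eqF.
by rewrite divr_ge0 ?mulr_ge0// ltW.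
Qed.

Lemma dual_residual_le : Dist (c - A^T *m z.2) orthant <= rho / st.
Proof.
set s := c - _; have [h [h0 _ hs ->]] := negative_part s.
have [->|/eqP hn] := eqVneq h 0.
  by rewrite enorm0 divr_ge0 ?gap_bound_ge0// ltW.
have hp := enorm_gt0 hn.
have k1 : 0 <= r * st / enorm h by rewrite divr_ge0 ?mulr_ge0// ltW.
pose d := (r * st / enorm h) *: h.
have := @gap_rho (z.1 + d, z.2).
rewrite saddle_gap_shift_primal -/s.
have -> : (z.1 + d, z.2) - z = (d, 0).
  by rewrite [z in X in _ - X]surjective_pairing; congr (_, _);
    rewrite ?subrr// addrC addKr.
have -> : - dot d s = r * (st * enorm h).
  by rewrite dotZl hs -enorm_sqr; field; rewrite gt_eqF.
rewrite ler_pM2l// ler_pdivlMr// (mulrC st); apply.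
  by move=> i; rewrite !mxE addr_ge0// mulr_ge0.
apply: le_trans (norm_primal _) _; rewrite enormZ ger0_norm//.
by rewrite le_eqVlt; apply/orP; left; apply/eqP; field; rewrite !gt_eqF.
Qed.

(** The test point is z scaled towards 0, as far as the radius r allows. *)
Lemma duality_gap_le B : r <= B -> normM A tau sigma z <= B ->
  dot c z.1 - dot b z.2 <= rho * B.
Proof.
move=> rB zB; have rho0 := gap_bound_ge0.
rewrite -saddle_gap_0; have [zr|rz] := leP (normM A tau sigma z) r.
  apply: (@le_trans _ _ (r * rho)); last by rewrite mulrC ler_wpM2l.
  by apply: gap_rho; rewrite ?sub0r ?NM ?step_normN -?NM//; exact: orthant0.
set N := normM A tau sigma z in zB rz.
have N0 : 0 < N := lt_trans r0 rz.
apply: (@le_trans _ _ (rho * N)); last by rewrite ler_wpM2l.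
have t0 : 0 < r / N by rewrite divr_gt0.
have t1 : r / N <= 1 by rewrite ler_pdivrMr// mul1r ltW.
have wt : orthant (z + (r / N) *: (0 - z)).1.
  by apply: (orthant_segment z0 (@orthant0 R n)); rewrite t0 t1.
have nt : normM A tau sigma (z + (r / N) *: (0 - z) - z) <= r.
  rewrite (addrC z) addrK sub0r scalerN NM step_normN step_normZ -NM -/N.
  by rewrite ger0_norm ?(ltW t0)// divfK ?gt_eqF.
have := gap_rho wt nt; rewrite saddle_gap_scale => H.
by rewrite -(ler_pM2l t0); apply: le_trans H _;
  rewrite mulrCA divfK ?gt_eqF// mulrC.
Qed.

Let thp := theta_p_star A b c.
Let thd := theta_d_star A b c.

(** (14/17) calN is 7 kappa (1/mu_p + 1/mu_d) (theta_p + theta_d + Dt), where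
    Dt is the sum of the last two ratios in calN. The objective gap is
    measured in units of g = |c| dual_weight = |q| primal_weight, in which
    weighted_error 0 is g Dt. *)
Lemma weighted_error_le_gap :
  r <= 7%:R / 2%:R * weighted_error 0 ->
  normM A tau sigma z <= 7%:R / 2%:R * weighted_error 0 ->
  weighted_error z <= 14%:R / 17%:R * calN A b c * rho.
Proof.
move=> rB zB; have rho0 := gap_bound_ge0.
have v0 := primal_weight_gt0; have u0 := dual_weight_gt0.
have gap0 := duality_gap_le rB zB.
have pr := primal_residual_le; have dr := dual_residual_le.
have [_ mup0 mup1 thp1] := primal_constants hLP.
have [_ mud0 mud1 thd1] := dual_constants hLP hc.
have [G0 eX eS] := residual_error_bound hLP hc z.2 z0.
rewrite /weighted_error.
move: G0 eX eS; set dx := _ / lam_min A; set ds := Dist _ orthant.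
set Dx := Dist z.1 _; set Ds := Dist _ (Sopt A b c).
set G := _ + _ + _; move=> G0 eX eS.
rewrite -/thp -/thd in G G0 eX eS thp1 thd1.
have thp0 : 0 <= thp := le_trans ler01 thp1.
have thd0 : 0 <= thd := le_trans ler01 thd1.
have dxu : dx <= u * rho.
  have -> : u * rho = rho / ss / lam_min A.
    by rewrite /dual_weight; field; rewrite !gt_eqF.
  by rewrite ler_wpM2r// invr_ge0 ltW.
have dsv : ds <= v * rho by rewrite mulrC.
pose g := enorm c * u.
have g0 : 0 < g by rewrite mulr_gt0.
have gE : g = enorm q * v := weight_balance.
pose Dt := Dist 0 (Xopt A b c) / enorm q + Dist c (Sopt A b c) / enorm c.
have e0E : weighted_error 0 = g * Dt.
  rewrite /weighted_error /= mulmx0 subr0 /Dt mulrDr {1}gE /g.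
  by field; rewrite !gt_eqF.
have NE : calN A b c = 17%:R / 2%:R * kappa A *
    ((mu_p A b c)^-1 + (mu_d A b c)^-1) * (thp + thd + Dt).
  by rewrite /calN (Dist_0_Vp hLP) (Dist_0_Vd hc) /thp /thd /Dt !addrA.
have Dt0 : 0 <= Dt by rewrite addr_ge0// divr_ge0 ?Dist_ge0 ?enorm_ge0.
pose H := G / g.
have HH : H <= rho * (7%:R / 2%:R * Dt + thp + thd).
  rewrite ler_pdivrMr// /G.
  have E1 : enorm c * thp * dx <= enorm c * thp * (u * rho).
    by rewrite ler_wpM2l// mulr_ge0 ?enorm_ge0.
  have E2 : enorm q * thd * ds <= enorm q * thd * (v * rho).
    by rewrite ler_wpM2l// mulr_ge0 ?enorm_ge0.
  have -> : rho * (7%:R / 2%:R * Dt + thp + thd) * g =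
    rho * (7%:R / 2%:R * (g * Dt)) + thp * rho * g + thd * rho * g by ring.
  rewrite -e0E {2}gE /g.
  have -> : thp * rho * (enorm c * u) = enorm c * thp * (u * rho) by ring.
  have -> : thd * rho * (enorm q * v) = enorm q * thd * (v * rho) by ring.
  exact: lerD (lerD gap0 E1) E2.
have H0 : 0 <= H by rewrite divr_ge0// ltW.
set P := (mu_p A b c)^-1 in NE; set Q := (mu_d A b c)^-1 in NE.
have P1 : 1 <= P by rewrite invf_ge1.
have Q1 : 1 <= Q by rewrite invf_ge1.
have uvE := weightM.
have vX : v * Dx <= 2%:R * kappa A * (rho * (1 + thp) + H * P).
  apply: (@le_trans _ _ (v * (dx * (1 + thp) + G / (enorm c * mu_p A b c)))).
    by apply: ler_wpM2l (ltW v0) _ _ _; rewrite mulrDr mulr1 (mulrC dx).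
  rewrite mulrDr (mulrDr (2%:R * _)) lerD//.
    have -> : 2%:R * kappa A * (rho * (1 + thp)) = v * (u * rho * (1 + thp)).
      by rewrite -uvE; ring.
    have thp10 : 0 <= 1 + thp := addr_ge0 ler01 thp0.
    by apply: ler_wpM2l (ltW v0) _ _ _; exact: ler_wpM2r thp10 _ _ dxu.
  rewrite le_eqVlt; apply/orP; left; apply/eqP.
  by rewrite -uvE /H /g /P; field; rewrite !gt_eqF.
have uS : u * Ds <= 2%:R * kappa A * (rho * thd + H * Q).
  apply: (@le_trans _ _ (u * (ds * thd + G / (enorm q * mu_d A b c)))).
    by rewrite ler_wpM2l ?(ltW u0)// (mulrC ds).
  rewrite mulrDr (mulrDr (2%:R * _)) lerD//.
    have -> : 2%:R * kappa A * (rho * thd) = u * (v * rho * thd).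
      by rewrite -uvE; ring.
    by rewrite ler_wpM2l ?(ltW u0)// ler_wpM2r.
  rewrite le_eqVlt; apply/orP; left; apply/eqP.
  by rewrite -uvE /H gE /Q; field; rewrite !gt_eqF.
apply: le_trans (lerD vX uS) _; rewrite NE.
rewrite -mulrDr.
have -> : 14%:R / 17%:R * (17%:R / 2%:R * kappa A * (P + Q) * (thp + thd + Dt))
  * rho
  = 2%:R * kappa A * (7%:R / 2%:R * ((P + Q) * (rho * (thp + thd + Dt)))) by
    field.
have k20 : 0 <= 2%:R * kappa A := mulr_ge0 (ler0n _ 2) (ltW k0).
by apply: ler_wpM2l k20 _ _ _; exact: error_arith.
Qed.

End Residuals.
End ErrorByGap.

(** * Inner loops *)

Section Phases.
Context {R : realType} {m n : nat}.
Variables (A : 'M[R]_(m, n)) (b : 'cV[R]_m) (c : 'cV[R]_n) (tau sigma : R).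
Local Notation Z := ('cV[R]_n * 'cV[R]_m)%type.
Local Notation q := (qvec A b).
Hypothesis hLP : LP_assumption A b c.
Hypothesis hc : A *m c = 0.
Hypothesis htau : tau = enorm q / (2%:R * kappa A * enorm c).
Hypothesis hsigma :
  sigma = enorm c / (2%:R * enorm q * lam_max A * lam_min A).

Local Notation avg := (pdhg_avg A b c tau sigma).
Local Notation nM := (normM A tau sigma).
Local Notation nrm := (step_norm A tau sigma).
Local Notation rho z zp := (gap A b c tau sigma (nM (z - zp)) z).

Section Restart.
Variable beta : R.
Local Notation rstep := (rPDHG_step A b c tau sigma beta).
Local Notation restart j k zp z :=
  (restart_cond A b c tau sigma beta j k zp z (avg k z)).

(** The inner loop stops at the first k at which the restart condition holds,
    so it is enough to exhibit one such K. *)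
Lemma restart_first (j K : nat) (zp z : Z) : (0 < K)%N -> ~ Zopt A b c z ->
  restart j K zp z ->
  exists k, [/\ (0 < k <= K)%N, restart j k zp z &
    iter k rstep (State j 0 zp z z 0) = State j.+1 0 z (avg k z) (avg k z) 0].
Proof.
move=> K0 nZ rK.
pose P k := (0 < k)%N && `[< restart j k zp z >].
have exP : exists k, P k by exists K; rewrite /P K0; exact/asboolP.
case: (ex_minnP exP) => k /andP[k0 /asboolP rk] kmin.
exists k; split=> //; first by rewrite k0 kmin// /P K0; exact/asboolP.
pose S i := State j i zp z (iter i (PDHGstep A b c tau sigma) z)
  (pdhg_sum A b c tau sigma i z).
have zbE i : i.+1%:R^-1 *: (pdhg_sum A b c tau sigma i z +
    PDHGstep A b c tau sigma (iter i (PDHGstep A b c tau sigma) z)) = avg i.+1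
      z.
  by rewrite /pdhg_avg pdhg_sumS.
have run i : (i < k)%N -> iter i rstep (State j 0 zp z z 0) = S i.
  elim: i => [|i IH] ik; first by rewrite /S /= /pdhg_sum big_ord0.
  rewrite iterS IH 1?ltnW// /rPDHG_step /=.
  case: asboolP => [[_ /nZ]//|_]; rewrite zbE.
  case: asboolP => [ri|_]; last by rewrite /S pdhg_sumS.
  suff : (k <= i.+1)%N by rewrite leqNgt ik.
  by apply: kmin; rewrite /P /=; exact/asboolP.
case: k k0 rk run {kmin} => // k _ rk run.
rewrite iterS run// /rPDHG_step /=.
case: asboolP => [[_ /nZ]//|_]; rewrite zbE.
by case: asboolP.
Qed.

End Restart.

Let tau0 := tau_gt0 hLP htau.
Let sigma0 := sigma_gt0 hLP hsigma.
Let A0 := A_neq0 hLP.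
Let ts := tau_sigma_lam_max hLP htau hsigma.
Let one_sq : (1 : R) ^+ 2 = 1. Proof. exact: expr1n. Qed.
Let N1_sq : (- 1 : R) ^+ 2 = 1. Proof. by rewrite sqrrN expr1n. Qed.

Local Notation werr := (weighted_error A b c tau sigma).
Local Notation e0 := (werr 0).
Local Notation C := (14%:R / 17%:R * calN A b c).

(* the saddle point used to bound how far the iterates travel from the origin *)
Variable zs0 : Z.
Hypothesis zs0_opt : Zopt A b c zs0.
Hypothesis zs0_near : nrm 1 (0 - zs0) <= e0.

Let zs0_ge0 : orthant zs0.1. Proof. by case: zs0_opt => [[[]]]. Qed.

(** zp and z stand for z^{i,0} and z^{i+1,0}; the index i counts the inner
    loops after the first one, each of which divides the gap by e. *)
Definition phase_inv (i : nat) (zp z : Z) : Prop :=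
  [/\ exists2 k, (0 < k)%N & z = avg k zp,
      nrm 1 (zp - zs0) <= e0 &
      rho z zp <= expR (- i%:R) * (21%:R / 4%:R * e0)].

Lemma phase_ge0 i zp z : phase_inv i zp z -> orthant z.1.
Proof. by case=> -[k k0 ->] _ _; exact: pdhg_avg_ge0. Qed.

Lemma phase_near i zp z : phase_inv i zp z -> nrm 1 (z - zs0) <= e0.
Proof.
case=> -[k k0 ->] H _; apply: le_trans H.
exact: (pdhg_avg_nonexpansive tau0 sigma0 A0 ts zs0_ge0 (Zopt_saddle hLP hc
  zs0_opt)).
Qed.

(** If the radius nM (z - zp) were 0, the inner loop would have returned to
    its starting point, which would then be a saddle point. *)
Lemma phase_error i zp z : phase_inv i zp z -> ~ Zopt A b c z ->
  werr z <= C * rho z zp.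
Proof.
move=> inv nZ; have z0 := phase_ge0 inv; have zn := phase_near inv.
have saddle0 := Zopt_saddle hLP hc zs0_opt.
case: inv => -[k k0 zE] zpn _.
have tri x y : nrm 1 (x + y) <= nrm 1 x + nrm 1 y by exact: step_normD.
have eqv x : nM x <= 7%:R / 4%:R * nrm 1 x by rewrite normME;
  exact: step_norm_equiv.
have r0 : 0 < nM (z - zp).
  rewrite lt_neqAle normME step_norm_ge0 andbT eq_sym; apply/negP => /eqP.
  move/(step_norm_eq0 tau0 sigma0 A0 ts N1_sq)/eqP;
    rewrite subr_eq0 => /eqP zzp.
  apply: nZ; apply: saddle_Zopt => // w w0.
  have fix_ : avg k zp = zp by rewrite -zE.
  by have := pdhg_avg_fixed tau0 sigma0 A0 ts k0 fix_ w0; rewrite -zE.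
have near_zp : nrm 1 (z - zp) <= 2%:R * e0.
  rewrite -(subrKA zs0); apply: le_trans (tri _ _) _.
  by rewrite (step_normB _ _ _ _ zs0) mulr_natl mulr2n; exact: lerD.
have near_0 : nrm 1 z <= 2%:R * e0.
  rewrite -[z](subrK zs0); apply: le_trans (tri _ _) _.
  rewrite mulr_natl mulr2n; apply: lerD => //.
  by rewrite -(step_normN _ _ _ _ zs0) -sub0r.
apply: (weighted_error_le_gap hLP hc htau hsigma z0 r0).
- move=> w w0 wr; rewrite zE in wr *.
  exact: (saddle_gap_le_gap tau0 sigma0 A0 ts zs0_ge0 saddle0 k0 w0 wr).
- apply: le_trans (eqv _) _; lra.
- apply: le_trans (eqv _) _; lra.
Qed.

(** After K steps from z the gap is at most (21/4) |z - zs| / K, where zs is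
    a saddle point near z; by phase_error this is at most 1/e of the gap at
    z. *)
Lemma phase_next K i zp z : (0 < K)%N -> 21%:R / 4%:R * expR 1 * C <= K%:R ->
  phase_inv i zp z -> ~ Zopt A b c z ->
  exists k z', [/\ (0 < k <= K)%N, phase_inv i.+1 z z' &
    iter k (rPDHG_step A b c tau sigma (expR 1)^-1) (State i.+1 0 zp z z 0) =
      State i.+2 0 z z' z' 0].
Proof.
move=> K0 KC inv nZ; have err := phase_error inv nZ; have zn := phase_near inv.
have [zs zs_opt zs_near] := Zopt_near hLP hc htau hsigma z.
have zs_ge0 : orthant zs.1 by case: zs_opt => [[[]]].
have KR : 0 < (K%:R : R) by rewrite ltr0n.
have rho0 : 0 <= rho z zp.
  case: (inv) => -[k k0 zE] _ _; rewrite zE.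
  exact: (gap_ge0 tau0 sigma0 A0 ts zs0_ge0 (Zopt_saddle hLP hc zs0_opt)).
have dec : rho (avg K z) z <= (expR 1)^-1 * rho z zp.
  apply: le_trans (pdhg_gap_le tau0 sigma0 A0 ts zs_ge0 (Zopt_saddle hLP hc
    zs_opt) z K0) _.
  rewrite ler_pdivrMr// -[leRHS]mulrA ler_pdivlMl ?expR_gt0//.
  apply: (@le_trans _ _ (21%:R / 4%:R * expR 1 * C * rho z zp)); last first.
    by rewrite [leLHS]mulrC ler_wpM2l.
  have -> : expR 1 * (21%:R / 4%:R * nrm 1 (z - zs)) =
    21%:R / 4%:R * expR 1 * nrm 1 (z - zs) by ring.
  rewrite -[leRHS]mulrA ler_wpM2l//; exact: le_trans zs_near err.
have [|k [kK rk runE]] := @restart_first (expR 1)^-1 i.+1 K zp z K0 nZ.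
  by right.
exists k, (avg k z); split=> //; split.
- by exists k => //; case/andP: kK.
- exact: zn.
case: rk => [[]//|[_ H]]; apply: le_trans H _.
case: inv => _ _ H.
have -> : expR (- i.+1%:R) = (expR 1)^-1 * expR (- i%:R) :> R.
  by rewrite -expRN -expRD -natr1 opprD addrC.
rewrite -[leRHS]mulrA.
by rewrite ler_pM2l// invr_gt0 expR_gt0.
Qed.

End Phases.

(** * The iteration count *)

Section IterationCount.
Context {R : realType} {m n : nat}.
Variables (A : 'M[R]_(m, n)) (b : 'cV[R]_m) (c : 'cV[R]_n) (tau sigma : R).
Local Notation Z := ('cV[R]_n * 'cV[R]_m)%type.
Local Notation q := (qvec A b).
Hypothesis hLP : LP_assumption A b c.
Hypothesis hc : A *m c = 0.
Hypothesis htau : tau = enorm q / (2%:R * kappa A * enorm c).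
Hypothesis hsigma :
  sigma = enorm c / (2%:R * enorm q * lam_max A * lam_min A).
Variable eps : R.
Hypothesis eps0 : 0 < eps.

Local Notation run := (rPDHG A b c tau sigma (expR 1)^-1 (0, 0)).
Local Notation attained := (attains A b c tau sigma (expR 1)^-1 (0, 0) eps).
Local Notation werr := (weighted_error A b c tau sigma).
Local Notation N := (calN A b c).
Local Notation err0 := (E_d A b c 0 (c - A^T *m 0)).

Lemma Zopt_attained t : inner (run t) = 0%N -> Zopt A b c (zstart (run t)) ->
  attained t.
Proof.
move=> it [ox oy]; split=> //; rewrite /E_d (Dist_mem0 ox).
by rewrite (Dist_mem0 ((Yopt_Sopt hLP _).1 oy)) maxxx ltW.
Qed.

(** The run may also stop at a saddle point, but there the target accuracy is
    attained. *)
Lemma run_phases K zs0 : (0 < K)%N ->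
  21%:R / 4%:R * expR 1 * (14%:R / 17%:R * N) <= K%:R ->
  Zopt A b c zs0 -> step_norm A tau sigma 1 (0 - zs0) <= werr 0 ->
  forall i, exists2 t, (t <= 1 + i * K)%N & attained t \/
    exists zp z,
      run t = State i.+1 0 zp z z 0 /\ phase_inv A b c tau sigma zs0 i zp z.
Proof.
move=> K0 KC zs0_opt zs0_near.
have tau0 := tau_gt0 hLP htau; have sigma0 := sigma_gt0 hLP hsigma.
have A0 := A_neq0 hLP; have ts := tau_sigma_lam_max hLP htau hsigma.
have zs0_ge0 : orthant zs0.1 by case: zs0_opt => [[[]]].
elim=> [|i [t tK [att|[zp [z [runE inv]]]]]].
- have [Z0|nZ0] := pselect (Zopt A b c (0, 0)).
    by exists 0%N => //; left; apply: Zopt_attained.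
  have [//||k [kK rk runE]] := @restart_first _ _ _ A b c tau sigma (expR 1)^-1
    0 1 (0, 0) (0, 0) _ nZ0.
    by left.
  exists k; first by case/andP: kK.
  right; exists (0, 0), (pdhg_avg A b c tau sigma k (0, 0)); split=> //.
  have k1 : k = 1%N by apply/eqP; rewrite eqn_leq andbC.
  split; first by exists k; rewrite ?k1.
    exact: zs0_near.
  have -> : expR (- 0%:R) = 1 :> R by rewrite oppr0 expR0.
  rewrite mul1r.
  apply: le_trans (pdhg_gap_le tau0 sigma0 A0 ts zs0_ge0 (Zopt_saddle hLP hc
    zs0_opt) _ _) _.
    by rewrite k1.
  by rewrite k1 divr1 ler_wpM2l//; lra.
- by exists t; [rewrite (leq_trans tK)// leq_add2l leq_mul2r leqnSn orbT|left].
have [oz|nz] := pselect (Zopt A b c z).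
  exists t; first by rewrite (leq_trans tK)// leq_add2l leq_mul2r leqnSn orbT.
  by left; apply: Zopt_attained; rewrite runE.
have [k [z' [/andP[k0 kK] inv' runE']]] :=
  phase_next hLP hc htau hsigma zs0_opt zs0_near K0 KC inv nz.
exists (k + t)%N; first by rewrite mulSn addnCA leq_add.
by right; exists z, z'; split=> //; rewrite /rPDHG iterD -/(run t) runE.
Qed.

Let cn : 0 < enorm c := enorm_gt0 (c_neq0 hLP).
Let qn : 0 < enorm q := enorm_gt0 (qvec_neq0 hLP).
Local Notation v := (primal_weight tau).
Local Notation u := (dual_weight A sigma).
Local Notation ratio := (Num.max (enorm c / enorm q) (enorm q / enorm c)).

Lemma ratio_ge1 : 1 <= ratio.
Proof.
rewrite le_max !ler_pdivlMr// !mul1r.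
exact: le_total.
Qed.

Lemma weight_le_ratio : v <= ratio * u /\ u <= ratio * v.
Proof.
have v0 := primal_weight_gt0 hLP htau; have u0 := dual_weight_gt0 hLP hsigma.
have bal := weight_balance hLP htau hsigma.
split.
  have -> : v = enorm c / enorm q * u.
    by rewrite mulrAC bal mulrAC divff ?mul1r// gt_eqF.
  by apply: ler_wpM2r; [exact: ltW|rewrite le_max lexx].
have -> : u = enorm q / enorm c * v.
  by rewrite mulrAC -bal mulrAC divff ?mul1r// gt_eqF.
by apply: ler_wpM2r; [exact: ltW|rewrite le_max lexx orbT].
Qed.

Lemma E_d_le_weighted z :
  E_d A b c z.1 (c - A^T *m z.2) * v <= ratio * werr z /\
  E_d A b c z.1 (c - A^T *m z.2) * u <= ratio * werr z.
Proof.
have v0 := primal_weight_gt0 hLP htau; have u0 := dual_weight_gt0 hLP hsigma.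
have [vu uv] := weight_le_ratio; have r1 := ratio_ge1.
rewrite /weighted_error /E_d; set r := ratio in vu uv r1 *.
set dx := Dist _ (Xopt _ _ _); set ds := Dist _ (Sopt _ _ _).
have dx0 : 0 <= dx := Dist_ge0 _ _; have ds0 : 0 <= ds := Dist_ge0 _ _.
have M w : 0 < w -> w <= r * v -> w <= r * u ->
    Num.max dx ds * w <= r * (v * dx + u * ds).
  move=> w0 wv wu; rewrite mulrC mulrDr !mulrA.
  have [dxs|dxs] := leP dx ds.
    apply: (@le_trans _ _ (r * u * ds)); first by rewrite ler_wpM2r.
    by rewrite lerDr mulr_ge0// mulr_ge0 ?(ltW v0)// (le_trans ler01).
  apply: (@le_trans _ _ (r * v * dx)); first by rewrite ler_wpM2r.
  by rewrite lerDl mulr_ge0// mulr_ge0 ?(ltW u0)// (le_trans ler01).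
by split; apply: M => //; rewrite ler_peMl ?(ltW v0) ?(ltW u0).
Qed.

Lemma calN_ge34 : 34%:R <= N.
Proof.
have [_ mup0 mup1 thp1] := primal_constants hLP.
have [_ mud0 mud1 thd1] := dual_constants hLP hc.
have k1 := kappa_ge1 hLP.
have P1 : 1 <= (mu_p A b c)^-1 by rewrite invf_ge1.
have Q1 : 1 <= (mu_d A b c)^-1 by rewrite invf_ge1.
have D1 : 0 <= Dist 0 (Xopt A b c) / Dist 0 (Vp A b) by rewrite divr_ge0
  ?Dist_ge0.
have D2 : 0 <= Dist c (Sopt A b c) / Dist 0 (Vd A c) by rewrite divr_ge0
  ?Dist_ge0.
rewrite /calN; set P := _ + _; set T := _ + _ + _.
have P2 : 2%:R <= (mu_p A b c)^-1 + (mu_d A b c)^-1 by lra.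
have T2 : 2%:R <= T by rewrite /T; lra.
have -> : 34%:R = 17%:R / 2%:R * 1 * 2%:R * 2%:R :> R by field.
by do 2!apply: ler_pM => //; lra.
Qed.

(** If the initial error is at most eps, no step is needed. Otherwise the
    argument of the logarithm exceeds 1, as calN >= 34, and floor(ln ...)
    inner loops after the first one suffice. *)
Lemma iteration_bound : exists2 t, attained t & t%:R <= Num.max 0
   (5%:R * expR 1 * N * ln (N * calD A b c * (err0 / eps)) + 1).
Proof.
have exp_arith (a e : R) : a < e + 1 -> - e <= 1 - a by lra.
have const_arith (x y k : R) : x <= y -> y <= k -> 0 <= y ->
  147%:R / 17%:R * x <= 32%:R * k by lra.
have c1417 : 0 <= 14%:R / 17%:R :> R by lra.
have c214 : 0 <= 21%:R / 4%:R :> R by lra.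
have [E0|E0] := leP err0 eps.
  exists 0%N; last by rewrite le_max lexx.
  by split.
have e1 : 1 <= expR 1 :> R by rewrite -(expR0 R) ler_expR.
have N34 := calN_ge34; have N0 : 0 < N by lra.
have k1 := kappa_ge1 hLP; have r1 := ratio_ge1.
have r0 : 0 < ratio by rewrite (lt_le_trans ltr01).
have k0 : 0 < kappa A by rewrite (lt_le_trans ltr01).
have err00 : 0 < err0 := lt_trans eps0 E0.
have D1 : 1 <= calD A b c.
  rewrite /calD /normQ;
    rewrite -[leLHS]mulr1 -[X in X * 1]mulr1 -[X in X * 1 * 1]mulr1.
  apply: ler_pM => //; apply: ler_pM => //; apply: ler_pM => //; lra.
have Eeps : 1 < err0 / eps by rewrite ltr_pdivlMr// mul1r.
set X := N * calD A b c * (err0 / eps).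
have X1 : 1 < X.
  apply: (lt_le_trans Eeps); apply: ler_peMl.
    by apply: ltW; exact: lt_trans Eeps.
  by apply: mulr_ege1 => //; lra.
set l := ln X.
have X0 : 0 < X by exact: lt_trans X1.
have l0 : 0 <= l by rewrite ln_ge0// ltW.
set C := 14%:R / 17%:R * N.
have C0 : 0 <= C by apply: mulr_ge0 c1417 _; exact: ltW.
pose K := (Num.truncn (21%:R / 4%:R * expR 1 * C)).+1.
have KC : 21%:R / 4%:R * expR 1 * C <= K%:R by rewrite ltW// truncnS_gt.
(* the rounding up costs 1, which is at most expR 1 * N / 34 *)
have KN : K%:R <= 5%:R * expR 1 * N.
  have KC0 : 0 <= 21%:R / 4%:R * expR 1 * C.
    by apply: mulr_ge0 C0; apply: mulr_ge0 c214 _; exact: expR_ge0.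
  have /andP[H _] := truncn_itv KC0.
  have -> : K%:R = (Num.truncn (21%:R / 4%:R * expR 1 * C))%:R + 1 :> R.
    by rewrite natr1.
  have : 1 <= expR 1 * N / 34%:R.
    rewrite ler_pdivlMr// mul1r; apply: le_trans N34 _.
    by apply: ler_peMl => //; exact: ltW.
  have CE : 21%:R / 4%:R * expR 1 * C = 147%:R / 34%:R * (expR 1 * N).
    by rewrite /C; field.
  rewrite CE in H *; rewrite -[5%:R * _ * _]mulrA; move: H.
  by set y := expR 1 * N; set k := (Num.truncn _)%:R; lra.
have [zs0 zs0_opt zs0_near] := Zopt_near hLP hc htau hsigma 0.
pose i := Num.truncn l.
have /andP[il li] := truncn_itv l0.
have [t tK att] := run_phases (isT : (0 < K)%N) KC zs0_opt zs0_near i.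
exists t; last first.
  rewrite le_max; apply/orP; right.
  have : (t%:R : R) <= (1 + i * K)%:R by rewrite ler_nat.
  move=> /le_trans; apply; rewrite natrD natrM addrC lerD2r mulrC.
  by apply: ler_pM.
case: att => // -[zp [z [runE inv]]].
have [oz|nz] := pselect (Zopt A b c z); first by apply: Zopt_attained;
  rewrite runE.
rewrite /attains runE; split=> //=.
have err := phase_error hLP hc htau hsigma zs0_opt zs0_near inv nz.
case: inv => _ _ dec.
have v0 := primal_weight_gt0 hLP htau; have u0 := dual_weight_gt0 hLP hsigma.
have w0 : werr 0 <= (u + v) * err0.
  rewrite /weighted_error /E_d mulrDl addrC lerD// ler_wpM2l ?(ltW v0) ?(ltW
    u0)//.
    by rewrite le_max lexx orbT.
  by rewrite le_max lexx.
have [Ev Eu] := E_d_le_weighted z.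
set Ez := E_d _ _ _ _ _ in Ev Eu *.
have uv0 : 0 < u + v by rewrite addr_gt0.
rewrite -(ler_pM2r uv0).
have main : Ez * (u + v) <= 2%:R * ratio * (C * (expR (- i%:R) * (21%:R / 4%:R
  * ((u + v) * err0)))).
  apply: (@le_trans _ _ (2%:R * ratio * werr z)).
    by rewrite mulrDr -mulrA mulr_natl mulr2n; exact: lerD.
  rewrite ler_wpM2l ?mulr_ge0 ?(ltW r0)//.
  apply: le_trans err _; rewrite ler_wpM2l//; apply: le_trans dec _.
  by rewrite ler_wpM2l ?expR_ge0// ler_wpM2l.
apply: le_trans main _.
have epsE : eps = N * calD A b c * err0 * expR (- l).
  rewrite expRN lnK ?posrE// /X; field.
  by rewrite (gt_eqF N0) (gt_eqF eps0) (gt_eqF err00) gt_eqF// (lt_le_trans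
    ltr01 D1).
have exp_l : expR (- i%:R) <= expR 1 * expR (- l).
  by rewrite -expRD ler_expR; apply: exp_arith; move: li; rewrite -natr1.
rewrite [in leRHS]epsE /calD /normQ.
have -> : 2%:R * ratio * (C * (expR (- i%:R) * (21%:R / 4%:R * ((u + v) *
  err0)))) =
  N * ratio * err0 * (u + v) * (147%:R / 17%:R * expR (- i%:R)) by rewrite /C;
    field.
have -> : N * (32%:R * expR 1 * kappa A * ratio) * err0 * expR (- l) * (u + v) =
  N * ratio * err0 * (u + v) * (32%:R * (kappa A * (expR 1 * expR (- l)))) by
    ring.
apply: ler_wpM2l.
  exact: mulr_ge0 (mulr_ge0 (mulr_ge0 (ltW N0) (ltW r0)) (ltW err00)) (ltW uv0).
have ee0 : 0 <= expR 1 * expR (- l) by rewrite mulr_ge0 ?expR_ge0.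
by apply: const_arith exp_l _ ee0; rewrite ler_peMl.
Qed.

End IterationCount.

Unset Implicit Arguments.

(* T is a natural number, so the bound is read as max(0, bound): when eps is
   larger than calN * calD * E_d(x^{0,0}, s^{0,0}) the logarithm is negative
   and the untruncated bound would be negative while T = 0. *)
Theorem theorem3p1 (R : realType) (m n : nat) (A : 'M[R]_(m, n))
    (b : 'cV[R]_m) (c : 'cV[R]_n)
    (hLP : LP_assumption A b c)
    (hc : A *m c = 0)
    (tau sigma : R)
    (htau : tau = enorm (qvec A b) / (2%:R * kappa A * enorm c))
    (hsigma : sigma =
       enorm c / (2%:R * enorm (qvec A b) * lam_max A * lam_min A))
    (eps : R) (heps : 0 < eps) :
  exists2 T : nat,
    total_iterations A b c tau sigma (expR 1)^-1 (0, 0) eps T &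
    T%:R <= Num.max 0
      (5%:R * expR 1 * calN A b c *
         ln (calN A b c * calD A b c * (E_d A b c 0 (c - A^T *m 0) / eps))
       + 1).
Proof.
have [t att tB] := iteration_bound hLP hc htau hsigma heps.
pose P k := `[< attains A b c tau sigma (expR 1)^-1 (0, 0) eps k >].
have exP : exists k, P k by exists t; exact/asboolP.
case: (ex_minnP exP) => T /asboolP attT Tmin; exists T.
  split=> // k kT attk; have : (T <= k)%N by apply: Tmin; exact/asboolP.
  by rewrite leqNgt kT.
apply: le_trans tB; rewrite ler_nat; apply: Tmin; exact/asboolP.
Qed.
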